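(* If $p_c(\mathcal L)$ is the critical threshold for site percolation on $\mathcal L$, then $p_c(\mathcal L)<\tfrac13$.
   Context: $\mathcal L=2\mathbb Z^3\cup(2\mathbb Z^3+(1,1,1))$ is the body centered cubic lattice graph: $v,w\in\mathcal L$ are adjacent iff $v-w\in\{(\pm2,0,0),(0,\pm2,0),(0,0,\pm2)\}$ or $v-w\in\{(\pm1,\pm1,\pm1)\}$ (so every vertex has degree $14$). Site percolation means each vertex is open independently with the same probability. *)

(* Defs.v *)
From HB Require Import structures.
From mathcomp Require Import all_boot all_order all_algebra.
From mathcomp Require Import all_classical all_reals all_analysis.
From mathcomp Require Import measurable_realfun.
From mathcomp Require Import zify ring lra.
Set Implicit Arguments.
Unset Strict Implicit.
Unset Printing Implicit Defensive.
Import Order.TTheory GRing.Theory Num.Theory.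
Import numFieldNormedType.Exports.
Local Open Scope classical_set_scope.
Local Open Scope ring_scope.

Definition open_events (V : Type) : set (set (V -> bool)) :=
  [set [set w : V -> bool | w v] | v in [set: V]].

(* Configurations V -> bool (true meaning open), with the product sigma-algebra,
   i.e. the one generated by the events that a given vertex is open. *)
Definition configuration (V : Type) := g_sigma_algebraType (@open_events V).

(* Independent Bernoulli(p) bits are read off a uniform variable u on [0, 1]:
   starting from [0, 1[, the current interval [l, l + w[ is cut at l + p * w, the
   bit is 1 iff u is to the left of the cut, and the half containing u becomes
   the next interval. The pair is (l, w) after n steps. *)
Fixpoint bernoulli_itv (R : realType) (p u : R) (n : nat) : R * R :=
  if n is m.+1 then
    let: (l, w) := bernoulli_itv p u m in
    if u < l + p * w then (l, p * w) else (l + p * w, (1 - p) * w)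
  else (0, 1).

Definition bernoulli_bit (R : realType) (p u : R) (n : nat) : bool :=
  let: (l, w) := bernoulli_itv p u n in u < l + p * w.

Lemma measurable_bernoulli_itv (R : realType) (p : R) (n : nat) :
  measurable_fun [set: R] (fun u => (bernoulli_itv p u n).1) /\
  measurable_fun [set: R] (fun u => (bernoulli_itv p u n).2).
Proof.
elim: n => [|n [ml mw]] /=; first by split; exact: measurable_cst.
have mpw : measurable_fun [set: R] (fun u => p * (bernoulli_itv p u n).2).
  exact: measurable_funM.
have mlpw : measurable_fun [set: R]
    (fun u => (bernoulli_itv p u n).1 + p * (bernoulli_itv p u n).2).
  exact: measurable_funD.
have mb : measurable_fun [set: R]
    (fun u : R => u < (bernoulli_itv p u n).1 + p * (bernoulli_itv p u n).2).
  by apply: measurable_fun_ltr => //; exact: measurable_id.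
split.
- rewrite (_ : (fun u => _) = (fun u : R =>
      if u < (bernoulli_itv p u n).1 + p * (bernoulli_itv p u n).2
      then (bernoulli_itv p u n).1
      else (bernoulli_itv p u n).1 + p * (bernoulli_itv p u n).2)).
    exact: measurable_fun_ifT.
  by apply/funext => u; case: (bernoulli_itv p u n) => l w /=; case: ifP.
- rewrite (_ : (fun u => _) = (fun u : R =>
      if u < (bernoulli_itv p u n).1 + p * (bernoulli_itv p u n).2
      then p * (bernoulli_itv p u n).2
      else (1 - p) * (bernoulli_itv p u n).2)).
    apply: measurable_fun_ifT => //.
    exact: measurable_funM.
  by apply/funext => u; case: (bernoulli_itv p u n) => l w /=; case: ifP.
Qed.

Lemma measurable_bernoulli_bit (R : realType) (p : R) (n : nat) :
  measurable [set u | bernoulli_bit p u n].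
Proof.
have [ml mw] := measurable_bernoulli_itv p n.
have mb : measurable_fun [set: R]
    (fun u : R => u < (bernoulli_itv p u n).1 + p * (bernoulli_itv p u n).2).
  apply: measurable_fun_ltr; first exact: measurable_id.
  apply: measurable_funD => //.
  exact: measurable_funM.
have -> : [set u | bernoulli_bit p u n] = [set: R] `&`
   (fun u : R => u < (bernoulli_itv p u n).1 + p * (bernoulli_itv p u n).2)
     @^-1` [set true].
  rewrite setTI; apply/seteqP; split => u /=; rewrite /bernoulli_bit;
  by case: (bernoulli_itv p u n).
exact: mb.
Qed.

Definition bernoulli_config (V : countType) (R : realType) (p u : R) :
  configuration V := fun v => bernoulli_bit p u (pickle v).

Lemma measurable_bernoulli_config (V : countType) (R : realType) (p : R) :
  measurable_fun [set: measurableTypeR R] (@bernoulli_config V R p).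
Proof.
apply: (@measurability _ _ _ (configuration V) _ _ (@open_events V)) => //.
move=> _ [_ [v _ <-]] <-; rewrite setTI.
exact: (measurable_bernoulli_bit p (pickle v)).
Qed.

Definition bernoulli_rv (V : countType) (R : realType) (p : R) :
    {mfun measurableTypeR R >-> configuration V} :=
  HB.pack (@bernoulli_config V R p)
    (@isMeasurableFun.Build _ _ (measurableTypeR R) (configuration V)
       (@bernoulli_config V R p) (@measurable_bernoulli_config V R p)).

(* P_p, the law under which the vertices are open independently with
   probability p; characterized by bernoulli_productE below. It is meant for
   p in [0, 1] and meaningless otherwise. *)
Definition bernoulli_product (V : countType) (R : realType) (p : R) :
    probability (configuration V) R :=
  distribution (uniform_prob (@ltr01 R)) (bernoulli_rv V p).

Fixpoint prefix_itv (R : realType) (p : R) (b : nat -> bool) (n : nat) : R * R :=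
  if n is m.+1 then
    let: (l, w) := prefix_itv p b m in
    if b m then (l, p * w) else (l + p * w, (1 - p) * w)
  else (0, 1).

Lemma prefix_itv_bounds (R : realType) (p : R) b n : 0 <= p <= 1 ->
  let: (l, w) := prefix_itv p b n in [/\ 0 <= l, 0 <= w & l + w <= 1].
Proof.
move=> /andP[p0 p1]; elim: n => [|n] /=; first by split; lra.
case: (prefix_itv p b n) => l w [l0 w0 lw]; case: (b n); split; try nra.
Qed.

Lemma prefix_itv_width (R : realType) (p : R) b n :
  (prefix_itv p b n).2 = \prod_(i <- iota 0 n) (if b i then p else 1 - p).
Proof.
elim: n => [|n IH]; first by rewrite big_nil.
rewrite -addn1 iotaD big_cat big_seq1 /= addn1 /= -IH add0n.
case: (prefix_itv p b n) => l w /=; case: (b n); exact: mulrC.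
Qed.

Lemma dyadic_prefix (R : realType) (p : R) b n u :
  (forall i, (i < n)%N -> bernoulli_bit p u i = b i) ->
  bernoulli_itv p u n = prefix_itv p b n.
Proof.
elim: n => [//|n IH] H /=; have := H n (ltnSn n).
rewrite /bernoulli_bit IH; last by move=> i /ltnW; exact: H.
by case: (prefix_itv p b n) => l w ->.
Qed.

Lemma prefix_sub (R : realType) (p : R) b n u : 0 <= p <= 1 -> 0 <= u <= 1 ->
  (forall i, (i < n)%N -> bernoulli_bit p u i = b i) ->
  (prefix_itv p b n).1 <= u <= (prefix_itv p b n).1 + (prefix_itv p b n).2.
Proof.
move=> p01 u01; elim: n => [|n IH] H /=; first by rewrite add0r.
have Hn i : (i < n)%N -> bernoulli_bit p u i = b i by move=> /ltnW; exact: H.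
have := H n (ltnSn n); rewrite /bernoulli_bit (dyadic_prefix Hn).
have := IH Hn; case: (prefix_itv p b n) => l w /= /andP[lu ul].
by case: (b n) => /= [ult|/negbT]; rewrite -?leNgt => *; apply/andP; split; nra.
Qed.

Lemma prefix_sup (R : realType) (p : R) b n u : 0 <= p <= 1 ->
  (prefix_itv p b n).1 <= u < (prefix_itv p b n).1 + (prefix_itv p b n).2 ->
  forall i, (i < n)%N -> bernoulli_bit p u i = b i.
Proof.
move=> p01; elim: n => [//|n IH] /= H.
have : (prefix_itv p b n).1 <= u <
       (prefix_itv p b n).1 + (prefix_itv p b n).2 /\
   ((u < (prefix_itv p b n).1 + p * (prefix_itv p b n).2) = b n).
  have := prefix_itv_bounds b n p01.
  case: (prefix_itv p b n) H => l w /= H [l0 w0 lw].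
  case: (b n) H => /= /andP[H1 H2]; split.
  - by apply/andP; split; nra.
  - by [].
  - by apply/andP; split; nra.
  - by apply/negbTE; rewrite -leNgt.
move=> [/IH Hn Hb] i; rewrite ltnS leq_eqVlt => /predU1P[->|/Hn//].
rewrite /bernoulli_bit (dyadic_prefix Hn); move: Hb.
by case: (prefix_itv p b n).
Qed.

Lemma uniform01_itv (R : realType) (l r : R) (x y : bool) :
  0 <= l -> l <= r -> r <= 1 ->
  uniform_prob (@ltr01 R) [set` Interval (BSide x l) (BSide y r)] = (r - l)%:E.
Proof.
move=> l0 lr r1; rewrite /uniform_prob.
rewrite (eq_integral (fun=> 1%:E)); last first.
  move=> u; rewrite inE /= => Hu; rewrite /uniform_pdf subr0 invr1 ifT //.
  move: Hu; rewrite in_itv /= => /andP[H1 H2].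
  by case: x y H1 H2 => -[] /= H1 H2; apply/andP; split; lra.
rewrite integral_cst//= mul1e lebesgue_measure_itv /= lte_fin.
case: ltP => [_|rl]; first by rewrite EFinB.
by rewrite (_ : r - l = 0) //; lra.
Qed.

Lemma measurable_bernoulli_bits (R : realType) (p : R) (b : nat -> bool) (s : seq nat) :
  measurable [set u : measurableTypeR R |
    forall i, i \in s -> bernoulli_bit p u i = b i].
Proof.
elim: s => [|j s IH].
  rewrite (_ : [set u | _] = setT) //.
  by apply/seteqP; split.
rewrite (_ : [set u | _] = [set u | bernoulli_bit p u j = b j] `&`
    [set u | forall i, i \in s -> bernoulli_bit p u i = b i]).
  apply: measurableI => //; have := measurable_bernoulli_bit p j.
  case: (b j) => // /measurableC; congr measurable.
  by apply/seteqP; split => u /=; case: bernoulli_bit.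
apply/seteqP; split => u /=.
  by move=> H; split=> [|i si]; apply: H; rewrite inE ?eqxx ?si ?orbT.
by move=> [H1 H2] i; rewrite inE => /predU1P[->|/H2].
Qed.

Lemma uniform01_prefix (R : realType) (p : R) (b : nat -> bool) n :
  0 <= p <= 1 ->
  uniform_prob (@ltr01 R)
    [set u | forall i, i \in iota 0 n -> bernoulli_bit p u i = b i] =
  (\prod_(i <- iota 0 n) (if b i then p else 1 - p))%:E.
Proof.
move=> p01; rewrite -prefix_itv_width.
have mA := measurable_bernoulli_bits p b (iota 0 n).
set A := [set u | _].
have Hsub u := @prefix_sub R p b n u p01.
have Hsup u := @prefix_sup R p b n u p01.
have := prefix_itv_bounds b n p01; move: Hsub Hsup.
case: (prefix_itv p b n) => l w /= Hsub Hsup [l0 w0 lw1].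
have PA : uniform_prob (@ltr01 R) A = uniform_prob (@ltr01 R) (A `&` `[0, 1]).
  exact: integral_uniform_pdf.
have E x y : uniform_prob (@ltr01 R)
    [set` Interval (BSide x l) (BSide y (l + w))] = w%:E.
  by rewrite uniform01_itv ?lerDl // addrAC subrr add0r.
apply/eqP; rewrite eq_le; apply/andP; split.
- rewrite PA -(E true false); apply: le_measure.
  + by rewrite inE; apply: measurableI.
  + by rewrite inE.
  + move=> u [Au]; rewrite /= !in_itv /= => u01; apply: Hsub => // i ni.
    by apply: Au; rewrite mem_iota.
- rewrite -(E true true); apply: le_measure; rewrite ?inE //.
  move=> u; rewrite /= in_itv /= => Hu i; rewrite mem_iota add0n => /= ni.
  exact: Hsup Hu _ ni.
Qed.

Lemma uniform01_bits (R : realType) (p : R) (b : nat -> bool) (s : seq nat) :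
  0 <= p <= 1 -> uniq s ->
  uniform_prob (@ltr01 R)
    [set u | forall i, i \in s -> bernoulli_bit p u i = b i] =
  (\prod_(i <- s) (if b i then p else 1 - p))%:E.
Proof.
move=> p01 us.
have [n sn] : exists n, {subset s <= iota 0 n}.
  exists (\max_(i <- s) i).+1 => i si; rewrite mem_iota add0n ltnS /=.
  by rewrite (big_rem i) //= leq_maxl.
have [m] := ubnP (n - size s); elim: m => // m IH in s b us sn *.
rewrite ltnS => ltm.
have [/allP ns|/allPn[k kn ks]] := boolP (all [in s] (iota 0 n)).
  have e : perm_eq s (iota 0 n).
    by apply: uniq_perm => //; [exact: iota_uniq|move=> i; apply/idP/idP; auto].
  rewrite (perm_big _ e) /= -uniform01_prefix //; congr uniform_prob.
  by apply/seteqP; split => u /= H i Hi; apply: H; rewrite ?(perm_mem e) // -(perm_mem e).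
pose b' c i := if i == k then c else b i.
have sz : (size (k :: s) <= n)%N.
  rewrite -(size_iota 0 n); apply: uniq_leq_size; first by rewrite /= ks.
  by move=> i; rewrite inE => /predU1P[->|/sn].
have F c : uniform_prob (@ltr01 R)
    [set u | forall i, i \in k :: s -> bernoulli_bit p u i = b' c i] =
    ((if c then p else 1 - p) * \prod_(i <- s) (if b i then p else 1 - p))%:E.
  rewrite IH /= ?ks //.
  - rewrite big_cons {1}/b' eqxx; congr (_ * _)%:E.
    apply: eq_big_seq => i si; rewrite /b'; case: eqP => // ik.
    by rewrite -ik si in ks.
  - by move=> i; rewrite inE => /predU1P[->|/sn].
  - by move: ltm sz => /=; lia.
have split_k : [set u | forall i, i \in s -> bernoulli_bit p u i = b i] =
   [set u | forall i, i \in k :: s -> bernoulli_bit p u i = b' true i] `|`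
   [set u | forall i, i \in k :: s -> bernoulli_bit p u i = b' false i].
  apply/seteqP; split => u /=.
    move=> H; case E : (bernoulli_bit p u k); [left|right] => i;
      rewrite inE /b' => /predU1P[->|si]; rewrite ?eqxx //;
      by case: eqP => [->//|_]; exact: H.
  move=> [] H i si; have := H i; rewrite inE si orbT /b' => /(_ isT) ->;
    by case: eqP => // ik; rewrite -ik si in ks.
rewrite split_k measureU //=.
- by rewrite !F -EFinD; congr _%:E; ring.
- exact: measurable_bernoulli_bits.
- exact: measurable_bernoulli_bits.
- apply/seteqP; split => // u /= [/(_ k)+ /(_ k)].
  by rewrite inE eqxx /b' eqxx => /(_ isT) -> /(_ isT).
Qed.

Lemma bernoulli_productE (V : countType) (R : realType) (p : R)
    (s : seq V) (w0 : V -> bool) :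
  0 <= p <= 1 -> uniq s ->
  bernoulli_product V p [set w | forall v, v \in s -> w v = w0 v] =
  (\prod_(v <- s) (if w0 v then p else 1 - p))%:E.
Proof.
move=> p01 us.
pose b n := if unpickle n is Some v then w0 v else true.
have bE v : b (pickle v) = w0 v by rewrite /b pickleK.
transitivity (uniform_prob (@ltr01 R)
  [set u | forall i, i \in map pickle s -> bernoulli_bit p u i = b i]).
  congr uniform_prob; apply/seteqP; split => u /= H.
    by move=> _ /mapP[v sv ->]; rewrite bE -(H v sv).
  by move=> v sv; rewrite -bE; apply: H; exact: map_f.
have us' : uniq (map pickle s).
  by rewrite map_inj_uniq //; exact: pcan_inj (@pickleK V).
rewrite uniform01_bits //.
by rewrite big_map; congr _%:E; apply: eq_bigr => v _; rewrite bE.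
Qed.

Definition open_cluster (V : eqType) (adj : rel V) (w : V -> bool) (x : V) :
    set V :=
  [set y | exists s : seq V, [/\ path adj x s, all w (x :: s) & last x s = y]].

Definition percolation (V : countType) (adj : rel V) : set (configuration V) :=
  [set w | exists x, infinite_set (open_cluster adj w x)].

Definition critical_threshold (V : countType) (adj : rel V) (R : realType) : R :=
  inf [set p : R | 0 <= p <= 1 /\
                   (0 < bernoulli_product V p (percolation adj))%E].

Definition in_2Z3 (v : int * int * int) : bool :=
  [&& (2 %| v.1.1)%Z, (2 %| v.1.2)%Z & (2 %| v.2)%Z].

Definition in_bcc (v : int * int * int) : bool :=
  in_2Z3 v || in_2Z3 (v - (1, 1, 1)).

Definition bcc := {v : int * int * int | in_bcc v}.
HB.instance Definition _ := SubCountable.on bcc.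

Definition bcc_adj : rel bcc := fun v w =>
  val v - val w \in
    [:: (2, 0, 0); (-2, 0, 0); (0, 2, 0); (0, -2, 0); (0, 0, 2); (0, 0, -2);
        (1, 1, 1); (1, 1, -1); (1, -1, 1); (1, -1, -1);
        (-1, 1, 1); (-1, 1, -1); (-1, -1, 1); (-1, -1, -1)].

(* Main.v *)
(* The projection along (1, 1, 1) maps the lattice onto the triangular lattice T,
   and every edge of T at the image of a vertex l lifts to two edges at l.
   Exploring a cluster of T, each newly examined site therefore corresponds to two
   unexamined lattice sites, so that percolation at p on the lattice dominates
   percolation at 1 - (1 - p)^2 on T; p = 3/10 gives 51/100 > 1/2.

   That T percolates above 1/2 follows from the argument of Duminil-Copin and
   Tassion. Let N(S) be the expected number of outer boundary vertices of a finite
   set S that the origin reaches through S at density 1/2. If N(S) < 1 for some S,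
   then the probability of reaching distance n decays exponentially at density
   1/2, which contradicts the fact that, by the Hex theorem and the symmetries of
   T, a rhombus is crossed with probability at least 1/2. Otherwise Russo's formula
   yields the differential inequality theta_n' >= 1 - theta_n on [1/2, 1[, hence a
   lower bound on theta_n(51/100) which is uniform in n. *)
Require Import Defs.
From mathcomp Require Import all_boot all_order all_algebra.
From mathcomp Require Import all_classical all_reals all_analysis.
From mathcomp Require Import zify ring lra.
Import Order.TTheory GRing.Theory Num.Theory.
Import numFieldNormedType.Exports.
Set Implicit Arguments.
Unset Strict Implicit.
Unset Printing Implicit Defensive.
Local Open Scope classical_set_scope.
Local Open Scope ring_scope.

(** * Expectations over finitely many independent Bernoulli bits *)

Definition upd (V : eqType) (w : V -> bool) (x : V) (b : bool) : V -> bool :=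
  fun v => if v == x then b else w v.

(* Expectation over independent Bernoulli(p) bits at the sites of s, which should
   be duplicate-free; the bits outside s are those of w. *)
Fixpoint bexp (V : eqType) (R : realType) (p : R) (s : seq V)
    (f : (V -> bool) -> R) (w : V -> bool) : R :=
  if s is x :: s' then
    p * bexp p s' f (upd w x true) + (1 - p) * bexp p s' f (upd w x false)
  else f w.

Definition ind (V : eqType) (R : realType) (A : (V -> bool) -> Prop)
  (w : V -> bool) : R := (`[< A w >])%:R.
Arguments ind {V} R A w.

Definition dep (V : eqType) (T : Type) (t : seq V) (f : (V -> bool) -> T) :=
  forall w1 w2, {in t, w1 =1 w2} -> f w1 = f w2.

Definition le_config (V : eqType) (w1 w2 : V -> bool) := forall v, w1 v -> w2 v.

Definition incr (V : eqType) (R : realType) (f : (V -> bool) -> R) :=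
  forall w1 w2, le_config w1 w2 -> f w1 <= f w2.

Section Expectation.
Variables (V : eqType) (R : realType).
Implicit Types (p : R) (s t : seq V) (f g : (V -> bool) -> R) (w : V -> bool).
Implicit Types (A B : (V -> bool) -> Prop).

Lemma updE w x b : upd w x b x = b. Proof. by rewrite /upd eqxx. Qed.

Lemma updC w x y a b : x != y ->
  upd (upd w x a) y b = upd (upd w y b) x a.
Proof.
move=> xy; apply/funext => v; rewrite /upd; case: eqP => // ->.
by rewrite eq_sym (negPf xy).
Qed.

Lemma upd_upd w x a b : upd (upd w x a) x b = upd w x b.
Proof. by apply/funext => v; rewrite /upd; case: eqP. Qed.

Lemma upd_id w x b : w x = b -> upd w x b = w.
Proof. by move=> wx; apply/funext => v; rewrite /upd; case: eqP => // ->. Qed.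

Lemma ind1 A w : A w -> ind R A w = 1.
Proof. by move=> h; rewrite /ind asboolT. Qed.

Lemma ind0 A w : ~ A w -> ind R A w = 0.
Proof. by move=> h; rewrite /ind asboolF. Qed.

Lemma ind_ge0 A w : 0 <= ind R A w. Proof. by rewrite /ind ler0n. Qed.

Lemma ind_le1 A w : ind R A w <= 1.
Proof. by rewrite /ind lern1 leq_b1. Qed.

Lemma ind_le A B w1 w2 : (A w1 -> B w2) -> ind R A w1 <= ind R B w2.
Proof.
move=> AB; have [Aw|Aw] := pselect (A w1); first by rewrite !ind1 //; exact: AB.
by rewrite ind0 // ind_ge0.
Qed.

Lemma ind_eq A B w1 w2 : (A w1 <-> B w2) -> ind R A w1 = ind R B w2.
Proof. by move=> [AB BA]; apply/eqP; rewrite eq_le !ind_le. Qed.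

Lemma bexp_cat p s t f w : bexp p (s ++ t) f w = bexp p s (bexp p t f) w.
Proof. by elim: s w => //= x s IH w; rewrite !IH. Qed.

Lemma bexpD p s f g w :
  bexp p s (fun w => f w + g w) w = bexp p s f w + bexp p s g w.
Proof. by elim: s w => //= x s IH w; rewrite !IH; ring. Qed.

Lemma bexpZ p s c f w : bexp p s (fun w => c * f w) w = c * bexp p s f w.
Proof. by elim: s w => //= x s IH w; rewrite !IH; ring. Qed.

Lemma bexp_cst p s c w : bexp p s (fun=> c) w = c.
Proof. by elim: s w => //= x s IH w; rewrite !IH; ring. Qed.

Lemma bexp_sum p s (I : Type) (r : seq I) (F : I -> (V -> bool) -> R) w :
  bexp p s (fun w => \sum_(i <- r) F i w) w = \sum_(i <- r) bexp p s (F i) w.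
Proof.
elim: r => [|i r IH].
  rewrite big_nil (_ : (fun=> _) = fun=> 0) ?bexp_cst //.
  by apply/funext => v; rewrite big_nil.
rewrite big_cons -IH -bexpD; congr bexp; apply/funext => v.
by rewrite big_cons.
Qed.

Lemma le_bexp p s f g w : 0 <= p <= 1 ->
  (forall w', (forall v, v \notin s -> w' v = w v) -> f w' <= g w') ->
  bexp p s f w <= bexp p s g w.
Proof.
move=> /andP[p0 p1]; elim: s w => [|x s IH] w H /=; first exact: H.
apply: lerD; apply: ler_wpM2l; rewrite ?subr_ge0 //; apply: IH => w' w'E;
  apply: H => v; rewrite inE negb_or => /andP[vx vs];
  by rewrite w'E // /upd (negPf vx).
Qed.

Lemma eq_bexp_dep p s t f w1 w2 : dep t f ->
  (forall v, v \in t -> v \notin s -> w1 v = w2 v) ->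
  bexp p s f w1 = bexp p s f w2.
Proof.
move=> ft; elim: s w1 w2 => [|x s IH] w1 w2 H /=.
  by apply: ft => v vt; exact: H.
congr (_ * _ + _ * _); apply: IH => v vt vs; rewrite /upd; case: eqP => // vx;
  by apply: H => //; rewrite inE negb_or vs andbT; apply/eqP.
Qed.

Lemma bexp_swap p s x y f w : x != y ->
  bexp p [:: x, y & s] f w = bexp p [:: y, x & s] f w.
Proof.
by move=> xy /=; rewrite !(updC _ _ _ xy); ring.
Qed.

Lemma bexp_move p s t x f w : uniq (x :: s) ->
  bexp p (s ++ x :: t) f w = bexp p (x :: s ++ t) f w.
Proof.
elim: s w => //= y s IH w; rewrite inE negb_or => /andP[/andP[xy xs] /andP[ys us]].
have ux : uniq (x :: s) by rewrite /= xs.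
rewrite !IH //; exact: (@bexp_swap p (s ++ t) y x f w _ ) || by
  rewrite -[RHS](@bexp_swap p (s ++ t)) // eq_sym.
Qed.

Lemma bexp_perm p s t f w : uniq s -> perm_eq s t -> bexp p s f w = bexp p t f w.
Proof.
elim: s t w => [|x s IH] t w /=; first by rewrite perm_sym => _ /perm_nilP ->.
move=> /andP[xs us] st.
have xt : x \in t by rewrite -(perm_mem st) mem_head.
case/splitPr: xt st => t1 t2 st.
have ut : uniq (t1 ++ x :: t2) by rewrite -(perm_uniq st) /= xs.
rewrite bexp_move /=; last first.
  by move: ut; rewrite cat_uniq /= negb_or; case/and3P=> -> /andP[-> _].
have e : perm_eq s (t1 ++ t2).
  by rewrite -(perm_cons x); apply: (perm_trans st); rewrite perm_catC /=
    perm_cons perm_catC.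
by rewrite !(IH _ _ us e).
Qed.

Lemma bexp_pick p s x f w : uniq s -> x \in s ->
  bexp p s f w = p * bexp p (rem x s) f (upd w x true) +
                 (1 - p) * bexp p (rem x s) f (upd w x false).
Proof. by move=> us xs; rewrite (bexp_perm _ _ _ us (perm_to_rem xs)). Qed.

Lemma dep_sub (T : Type) s t (f : (V -> bool) -> T) :
  {subset s <= t} -> dep s f -> dep t f.
Proof. by move=> st fs w1 w2 H; apply: fs => v /st; exact: H. Qed.

Lemma dep_ind t A : (forall w1 w2, {in t, w1 =1 w2} -> A w1 -> A w2) ->
  dep t (ind R A).
Proof.
move=> H w1 w2 e; apply: ind_eq; split; apply: H => // v vt.
by rewrite e.
Qed.

(** Sites outside [t] can be moved to the innermost positions, where averaging changes nothing
    because the weights [p] and [1 - p] add up to 1. Expectations over different finite windows thus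
    become comparable. *)
Lemma bexp_dep p s t f w1 w2 : uniq s -> uniq t -> {subset t <= s} -> dep t f ->
  bexp p s f w1 = bexp p t f w2.
Proof.
move=> us ut ts ft.
have e : perm_eq s (t ++ [seq v <- s | v \notin t]).
  apply: uniq_perm => //.
    rewrite cat_uniq ut filter_uniq // andbT; apply/hasPn => v.
    by rewrite mem_filter => /andP[].
  move=> v; rewrite mem_cat mem_filter /=.
  by case vt: (v \in t) => //=; rewrite ts.
rewrite (bexp_perm _ _ _ us e) bexp_cat (_ : bexp p [seq v <- s | v \notin t] f = f).
  by apply: (eq_bexp_dep p ft) => v ->.
apply/funext => w.
have : {in t, forall v, v \notin [seq v <- s | v \notin t]}.
  by move=> v vt; rewrite mem_filter /= vt.
elim: [seq v <- s | v \notin t] w => //= x r IH w H.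
have fu b : f (upd w x b) = f w.
  apply: ft => v vt; rewrite /upd; case: eqP => // vx.
  by have := H _ vt; rewrite vx mem_head.
have Hr : {in t, forall v, v \notin r}.
  by move=> v /H; rewrite inE negb_or => /andP[].
by rewrite !IH // !fu; ring.
Qed.

Lemma bexp_incr p s f : 0 <= p <= 1 -> incr f -> incr (bexp p s f).
Proof.
move=> /andP[p0 p1] fi; elim: s => [|x s IH] w1 w2 H //=; first exact: fi.
apply: lerD; apply: ler_wpM2l; rewrite ?subr_ge0 //; apply: IH => v;
  by rewrite /upd; case: eqP => // _; exact: H.
Qed.

Lemma le_upd w x b : le_config (upd w x false) (upd w x b).
Proof. by move=> v; rewrite /upd; case: eqP. Qed.

Lemma bexp_incr_param p q s f w : 0 <= p -> p <= q -> q <= 1 -> incr f ->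
  bexp p s f w <= bexp q s f w.
Proof.
move=> p0 pq q1 fi; elim: s w => [|x s IH] w //=.
have := IH (upd w x true); have := IH (upd w x false).
have : bexp q s f (upd w x false) <= bexp q s f (upd w x true).
  by apply: bexp_incr; [lra|exact: fi|exact: le_upd].
set a := bexp p _ _ _; set b := bexp p _ _ _; set c := bexp q _ _ _.
set d := bexp q _ _ _ => H1 H2 H3.
have h1 : p * b <= p * d by apply: ler_wpM2l.
have h2 : (1 - p) * a <= (1 - p) * c by apply: ler_wpM2l => //; lra.
(* Raising the density moves weight [q - p] from the smaller value [c] to the larger value [d]. *)
have h3 : 0 <= (q - p) * (d - c) by apply: mulr_ge0; lra.
nra.
Qed.

(** On the left the sites of [t] outside [s] stay closed; making them random can only open some of
    them. *)
Lemma bexp_sub p s t f w : 0 <= p <= 1 -> uniq s -> uniq t -> {subset s <= t} ->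
  incr f -> (forall v, v \in t -> v \notin s -> w v = false) ->
  bexp p s f w <= bexp p t f w.
Proof.
move=> p01 us ut st fi wF.
have e : perm_eq t ([seq v <- t | v \notin s] ++ s).
  apply: uniq_perm => //.
    rewrite cat_uniq us filter_uniq // andbT /=; apply/hasPn => v vs.
    by rewrite mem_filter /= vs.
  move=> v; rewrite mem_cat mem_filter /=.
  by case vs: (v \in s) => /=; rewrite ?orbF // st.
rewrite (bexp_perm _ _ _ ut e) bexp_cat.
have : forall v, v \in [seq v <- t | v \notin s] -> w v = false.
  by move=> v; rewrite mem_filter => /andP[/= H1 H2]; exact: wF.
have : incr (bexp p s f) by apply: bexp_incr.
move: (bexp p s f) => h hi; elim: [seq v <- t | v \notin s] w {wF} => //= x r IH w H.
have Hx : upd w x false = w by apply: upd_id; apply: H; rewrite mem_head.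
rewrite Hx.
have a1 : h w <= bexp p r h w by apply: IH => v vr; apply: H; rewrite inE vr orbT.
have a2 : bexp p r h w <= bexp p r h (upd w x true).
  by rewrite -{1}Hx; apply: bexp_incr => //; exact: le_upd.
nra.
Qed.

(* The next bit to be revealed may depend on the values already seen. *)
Lemma bexp_explore p (I : seq V -> (V -> bool) -> Prop) f g s w : 0 <= p <= 1 ->
  (forall s w, uniq s -> I s w -> bexp p s f w <= bexp p s g w \/
     exists2 y, y \in s & forall b, I (rem y s) (upd w y b)) ->
  uniq s -> I s w -> bexp p s f w <= bexp p s g w.
Proof.
move=> /andP[p0 p1] H; have [n] := ubnP (size s).
elim: n s w => // n IH s w; rewrite ltnS => sn us Isw.
have [//|[y ys Iy]] := H s w us Isw.
have sz : (size (rem y s) < n)%N.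
  by rewrite size_rem //; case: s ys sn {us Isw Iy}.
rewrite !(bexp_pick _ _ _ us ys).
by apply: lerD; apply: ler_wpM2l; rewrite ?subr_ge0 //; apply: IH;
  rewrite ?rem_uniq.
Qed.

Lemma bexp_flip s f w :
  bexp (1 / 2 : R) s f w =
  bexp (1 / 2) s (fun w => f (fun v => ~~ w v)) (fun v => ~~ w v).
Proof.
elim: s w => [|x s IH] w /=.
  by congr f; apply/funext => v; rewrite negbK.
have e b : (fun v => ~~ upd w x b v) = upd (fun v => ~~ w v) x (~~ b).
  by apply/funext => v; rewrite /upd; case: eqP.
by rewrite !IH !e /=; field.
Qed.

Lemma bexp_map (V' : eqType) (h : V -> V') p s f (w' : V' -> bool) :
  injective h ->
  bexp p s f (w' \o h) = bexp p (map h s) (fun w'' : V' -> bool => f (w'' \o h)) w'.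
Proof.
move=> hi; elim: s w' => //= x s IH w'; rewrite -!IH.
have e b : upd w' (h x) b \o h = upd (w' \o h) x b.
  by apply/funext => v; rewrite /upd /= (inj_eq hi).
by rewrite !e.
Qed.

Lemma incr_ind A : (forall w1 w2, le_config w1 w2 -> A w1 -> A w2) -> incr (ind R A).
Proof. by move=> H w1 w2 le; apply: ind_le; exact: H. Qed.

End Expectation.

(** * Russo's formula *)

(** The derivative of [bexp] in [p], by the product rule along the recursion. *)
Fixpoint dbexp (V : eqType) (R : realType) (p : R) (s : seq V)
    (f : (V -> bool) -> R) (w : V -> bool) : R :=
  if s is x :: s' then
    bexp p s' f (upd w x true) - bexp p s' f (upd w x false) +
    (p * dbexp p s' f (upd w x true) + (1 - p) * dbexp p s' f (upd w x false))
  else 0.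

Section Russo.
Variables (V : eqType) (R : realType).
Implicit Types (p : R) (s : seq V) (f : (V -> bool) -> R) (w : V -> bool).

Lemma is_derive_bexp p s f w :
  is_derive p 1 (fun q => bexp q s f w) (dbexp p s f w).
Proof.
elim: s w => [|x s IH] w /=; first exact: is_derive_cst.
have H1 := IH (upd w x true); have H2 := IH (upd w x false).
apply: is_derive_eq.
rewrite /GRing.scale /= !mulr1 ; ring.
Qed.

Lemma bexp_upd p s f x b w : x \notin s ->
  bexp p s (fun w => f (upd w x b)) w = bexp p s f (upd w x b).
Proof.
elim: s w => //= y s IH w; rewrite inE negb_or => /andP[xy xs].
by rewrite !IH // !(@updC _ _ y x) // eq_sym.
Qed.

(* Russo's formula. A pivotal bit is closed with probability 1 - p independently
   of being pivotal, so that summing over the closed pivotal bits absorbs the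
   factor 1 - p. *)
Lemma russo p s f w : uniq s ->
  (1 - p) * dbexp p s f w =
  bexp p s (fun w => \sum_(y <- s) (f (upd w y true) - f w)) w.
Proof.
elim: s w => [|x s IH] w; first by rewrite /= big_nil mulr0.
move=> /= /andP[xs us].
have E w' : bexp p s (fun w => \sum_(y <- x :: s) (f (upd w y true) - f w)) w' =
   bexp p s f (upd w' x true) - bexp p s f w' + (1 - p) * dbexp p s f w'.
  rewrite IH // -bexp_upd // -[- bexp p s f w']mulN1r -bexpZ -!bexpD.
  by congr bexp; apply/funext => v; rewrite big_cons mulN1r.
by rewrite !E !upd_upd; ring.
Qed.

(** Write theta for the expectation as a function of the density. Russo's formula turns the
    hypothesis into theta' >= 1 - theta. By the mean value theorem the increment is [p1 - p0] times
    theta' at some [c], and 1 - theta is at least as large at [c] as at [p1]. *)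
Lemma bexp_mean_value p0 p1 s f w : 0 <= p0 -> p0 < p1 -> p1 < 1 -> uniq s ->
  incr f -> (forall w, f w <= 1) ->
  (forall p, p0 <= p <= p1 -> bexp p s (fun w => 1 - f w) w <=
     bexp p s (fun w => \sum_(y <- s) (f (upd w y true) - f w)) w) ->
  (p1 - p0) * (1 - bexp p1 s f w) <= bexp p1 s f w - bexp p0 s f w.
Proof.
move=> p00 p01 p11 us fi f1 H.
have cF : {within `[p0, p1]%classic, continuous (fun q => bexp q s f w)}.
  apply: derivable_within_continuous => q _.
  by have [] := is_derive_bexp q s f w.
have [c] := MVT p01 (fun q _ => is_derive_bexp q s f w) cF.
rewrite in_itv /= => /andP[p0c cp1] ->.
have := H c; rewrite (ltW p0c) (ltW cp1) => /(_ isT); rewrite -russo //.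
have -> : bexp c s (fun w => 1 - f w) w = 1 - bexp c s f w.
  rewrite -[- bexp c s f w]mulN1r -bexpZ -[X in _ = X + _](bexp_cst c s 1 w) -bexpD.
  by congr bexp; apply/funext => v; rewrite mulN1r.
have : bexp c s f w <= bexp p1 s f w.
  by apply: bexp_incr_param => //; lra.
have : bexp p1 s f w <= 1.
  rewrite -[leRHS](bexp_cst p1 s 1 w); apply: le_bexp => //.
  by lra.
move: (bexp c s f w) (bexp p1 s f w) (dbexp c s f w) => a b d b1 ab cd.
have h1 : 0 <= d.
  by rewrite -(@pmulr_rge0 _ (1 - c)); lra.
have h2 : 1 - b <= d by nra.
by rewrite mulrC; apply: ler_wpM2r => //; lra.
Qed.

End Russo.

(** * Connectivity inside a finite set *)

(** [ok] constrains every vertex of the path after the start, so a path may begin at a closed vertex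
    or outside the region. *)
Inductive reach (V : eqType) (adj : rel V) (ok : V -> bool) (x : V) : V -> Prop :=
| reach_refl : reach adj ok x x
| reach_step y z : reach adj ok x y -> adj y z -> ok z -> reach adj ok x z.

Section Reach.
Variables (V : eqType) (adj : rel V).
Implicit Types (ok : V -> bool) (s : seq V) (w : V -> bool).

Lemma reach_mono ok1 ok2 x y : (forall v, ok1 v -> ok2 v) ->
  reach adj ok1 x y -> reach adj ok2 x y.
Proof.
move=> H; elim=> [|u v _ IH uv okv]; first exact: reach_refl.
by apply: reach_step IH uv _; exact: H.
Qed.

Lemma reach_trans ok x y z :
  reach adj ok x y -> reach adj ok y z -> reach adj ok x z.
Proof.
by move=> xy; elim=> [//|u v _ IH uv okv]; apply: reach_step IH uv okv.
Qed.

Lemma reach_ok ok x y : reach adj ok x y -> y = x \/ ok y.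
Proof. by case; [left|right]. Qed.

(** A path that returns to [x] can be restarted there, so the state of [x] has no influence on what
    it reaches. *)
Lemma reach_skip ok x y :
  reach adj ok x y -> reach adj (fun v => (v != x) && ok v) x y.
Proof.
elim=> [|u v _ IH uv okv]; first exact: reach_refl.
have [->|vx] := eqVneq v x; first exact: reach_refl.
by apply: reach_step IH uv _; rewrite vx.
Qed.

(** The last step, to [z], is free of any condition on the state of [z]; this makes [exits] an event
    of the sites of [s] alone. *)
Definition leaves ok s x := exists y z, [/\ reach adj ok x y, adj y z & z \notin s].

Definition exits s w x := leaves (fun v => (v \in s) && w v) s x.

Definition touches s x y w :=
  exists2 v, reach adj (fun v => (v \in s) && w v) x v & adj v y.

Lemma leaves_mono ok1 ok2 s x : (forall v, ok1 v -> ok2 v) ->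
  leaves ok1 s x -> leaves ok2 s x.
Proof.
by move=> H [y [z [xy yz zs]]]; exists y, z; split=> //; exact: reach_mono H _.
Qed.

Lemma leaves_prepend ok s x y : adj x y -> ok y -> leaves ok s y -> leaves ok s x.
Proof.
move=> xy oky [a [b [ya ab bs]]]; exists a, b; split=> //.
exact: reach_trans (reach_step (reach_refl _ _ _) xy oky) ya.
Qed.

(** The path is followed up to its first step out of [s], if there is one. *)
Lemma reach_cut ok s x y : reach adj ok x y -> x \in s ->
  reach adj (fun v => (v \in s) && ok v) x y /\ y \in s \/
  leaves (fun v => (v \in s) && ok v) s x.
Proof.
move=> xy xs; elim: xy => [|u v _ [[xu us]|] uv okv]; last by right.
  by left; split=> //; exact: reach_refl.
have [vs|vs] := boolP (v \in s); last by right; exists u, v.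
by left; split=> //; apply: reach_step xu uv _; rewrite vs.
Qed.

Lemma exits_sub s t w x : {subset t <= s} -> x \in t -> exits s w x -> exits t w x.
Proof.
move=> ts xt [y [z [xy yz zs]]].
have sub v : (v \in t) && ((v \in s) && w v) -> (v \in t) && w v.
  by move=> /and3P[-> _ ->].
have [[xy' yt]|] := reach_cut xy xt; last exact: leaves_mono.
exists y, z; split=> //; first exact: reach_mono xy'.
by apply: contra zs; exact: ts.
Qed.

Lemma exits_incr s w1 w2 x : le_config w1 w2 -> exits s w1 x -> exits s w2 x.
Proof.
by move=> le; apply: leaves_mono => v /andP[-> /=]; exact: le.
Qed.

Lemma touches_incr s x y w1 w2 :
  le_config w1 w2 -> touches s x y w1 -> touches s x y w2.
Proof.
move=> le [v xv vy]; exists v => //; apply: reach_mono xv => u /andP[-> /=].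
exact: le.
Qed.

Lemma exits_agree s w1 w2 x : {in s, w1 =1 w2} -> exits s w1 x -> exits s w2 x.
Proof.
by move=> e; apply: leaves_mono => v /andP[vs]; rewrite e // vs.
Qed.

Lemma touches_agree s x y w1 w2 :
  {in s, w1 =1 w2} -> touches s x y w1 -> touches s x y w2.
Proof.
move=> e [v xv vy]; exists v => //; apply: reach_mono xv => u /andP[us].
by rewrite e // us.
Qed.

End Reach.

Lemma ler_sum_uniq (I : eqType) (R : realDomainType) (r1 r2 : seq I) (F G : I -> R) :
  uniq r1 -> uniq r2 -> {in r2, forall i, 0 <= G i} ->
  {in r1, forall i, F i <> 0 -> i \in r2 /\ F i <= G i} ->
  \sum_(i <- r1) F i <= \sum_(i <- r2) G i.
Proof.
move=> u1 u2 G0 FG.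
have e : perm_eq [seq i <- r1 | i \in r2] [seq i <- r2 | i \in r1].
  apply: uniq_perm; rewrite ?filter_uniq // => i.
  by rewrite !mem_filter andbC.
rewrite (bigID [in r2]) /= [X in _ + X]big1_seq ?addr0; last first.
  move=> i /andP[ir2 ir1]; have [//|/eqP Fi] := eqVneq (F i) 0.
  by have [] := FG i ir1 Fi; rewrite (negPf ir2).
rewrite -big_filter (perm_big _ e) /= big_filter [leRHS](bigID [in r1]) /=.
rewrite -[leLHS]addr0; apply: lerD.
  rewrite !(big_seq_cond (fun i => i \in r1)); apply: ler_sum => i /andP[ir2 ir1].
  have [->|/eqP Fi] := eqVneq (F i) 0; first exact: G0.
  by have [] := FG i ir1 Fi.
by rewrite big_seq_cond; apply: sumr_ge0 => i /andP[ir2 _]; exact: G0.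
Qed.

(** * Pivotal sites and exponential decay *)

Section DuminilCopinTassion.
Variables (V : eqType) (R : realType) (nb : V -> seq V) (o : V).
Let adj : rel V := fun x y => y \in nb x.
Implicit Types (p : R) (s : seq V) (w : V -> bool).

Definition outer_boundary s := [seq y <- undup (flatten (map nb s)) | y \notin s].

Lemma outer_boundaryP s x y : x \in s -> adj x y -> y \notin s ->
  y \in outer_boundary s.
Proof.
move=> xs xy ys; rewrite mem_filter ys mem_undup.
by apply/flattenP; exists (nb x) => //; exact: map_f.
Qed.

(* In the notation of Duminil-Copin and Tassion, the expectation of touched S is
   phi_p(S) / p, since the boundary vertex reached need not be open. *)
Definition touched s w : R :=
  \sum_(y <- outer_boundary s) ind R (touches adj s o y) w.

Lemma reach_in s ok x : o \in s ->
  reach adj (fun v => (v \in s) && ok v) o x -> x \in s.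
Proof. by move=> os /reach_ok[->|/andP[]]. Qed.

Lemma touched_incr s : incr (touched s).
Proof.
move=> w1 w2 le; apply: ler_sum => y _.
by apply: incr_ind le => ? ?; exact: touches_incr.
Qed.

Lemma touched_dep s : dep s (touched s).
Proof.
move=> w1 w2 e; apply: eq_bigr => y _.
by apply: (@dep_ind _ _ s) e => ? ?; exact: touches_agree.
Qed.

(* Exploring the open clusters of the complement of L leaves an unexplored set
   S which, when it contains o, is surrounded by closed vertices joined to the
   complement of L; those that o touches through S are pivotal. *)
Lemma pivotal_bound p L w : 0 <= p <= 1 -> uniq L -> o \in L ->
  (forall S w, uniq S -> o \in S -> 1 <= bexp p S (touched S) w) ->
  bexp p L (fun w => 1 - ind R (exits adj L ^~ o) w) w <=
  bexp p L (fun w => \sum_(y <- L)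
    (ind R (exits adj L ^~ o) (upd w y true) - ind R (exits adj L ^~ o) w)) w.
Proof.
move=> p01 uL oL H.
(* [G s w v] says that a path from [v] through revealed open vertices leads out of [L]; [v] itself
   may be closed or unrevealed. Only vertices with this property get revealed, which is the
   invariant [I]. *)
pose G s w := leaves adj (fun u => [&& u \in L, u \notin s & w u]) L.
pose I s w := {subset s <= L} /\ forall y, y \in L -> y \notin s -> G s w y.
have step s' w' y b v : uniq s' -> y \in s' -> G s' w' v -> G (rem y s') (upd w' y b) v.
  move=> us ys; apply: leaves_mono => u /and3P[-> us' wu] /=.
  rewrite (contra _ us') /=; last exact: mem_rem.
  by rewrite /upd; case: eqP us' => // ->; rewrite ys.
have upd_true w' y : le_config w' (upd w' y true).
  by move=> v; rewrite /upd; case: eqP.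
have pos w' : {in L, forall y, 0 <= ind R (exits adj L ^~ o) (upd w' y true)
    - ind R (exits adj L ^~ o) w'}.
  by move=> y _; rewrite subr_ge0; apply: ind_le; exact: exits_incr.
apply: (bexp_explore (I := I)) => // [s' w' us' [sL sG]|]; last first.
  by split=> // y ->.
have [[y ys Gy]|noG] := pselect (exists2 y, y \in s' & G s' w' y).
  right; exists y => // b; split=> [v /mem_rem|v vL]; first exact: sL.
  rewrite mem_rem_uniq // inE negb_and negbK => /orP[/eqP ->|vs].
    exact: step.
  by apply: step => //; exact: sG.
left.
have GE w'' v : (forall u, u \notin s' -> w'' u = w' u) ->
    G s' w' v -> exits adj L w'' v.
  by move=> e; apply: leaves_mono => u /and3P[-> us wu]; rewrite e.
(* Once [o] is revealed, the invariant provides a path from [o] out of [L], and the left side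
   vanishes. *)
have [os|os] := boolP (o \in s'); last first.
  apply: le_bexp => // w'' e.
  have Go : exits adj L w'' o by apply: GE => //; exact: sG.
  by rewrite [X in 1 - X]ind1 // subrr big_seq; apply: sumr_ge0 => y; exact: pos.
apply: (@le_trans _ _ 1).
  rewrite -[leRHS](bexp_cst p s' 1 w'); apply: le_bexp => // w'' _.
  by have := @ind_ge0 _ R (exits adj L ^~ o) w''; lra.
apply: le_trans (H s' w' us' os) _; apply: le_bexp => // w'' e.
have nG v : v \in s' -> ~ G s' w' v by move=> vs Gv; apply: noG; exists v.
(* The exploration has stopped: a neighbour of an unrevealed vertex lies in [L], and is closed if
   revealed, since otherwise that unrevealed vertex would satisfy [G]. *)
have inL v y : v \in s' -> adj v y -> y \in L.
  move=> vs vy; apply: contra_notT (nG v vs) => yL.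
  by exists v, y; split=> //; exact: reach_refl.
have closed v y : v \in s' -> adj v y -> y \notin s' -> ~ w' y.
  move=> vs vy ys wy; have yL := inL _ _ vs vy.
  apply: (nG v vs); apply: leaves_prepend vy _ (sG _ yL ys).
  by rewrite yL ys.
have stay y : reach adj (fun v => (v \in L) && w'' v) o y -> y \in s'.
  elim=> // u v _ us uv /andP[vL wv]; apply/negPn/negP => vs.
  by apply: (closed u v) => //; rewrite -e.
have nex : ~ exits adj L w'' o.
  move=> [y [z [/stay ys yz zL]]].
  by rewrite (inL _ _ ys yz) in zL.
apply: ler_sum_uniq (uL) (pos w'') _; first by rewrite filter_uniq ?undup_uniq.
move=> y; rewrite mem_filter => /andP[ys _].
have [tch _|ntch] := pselect (touches adj s' o y w''); last by rewrite ind0.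
have [v ov vy] := tch; have vs := reach_in os ov.
have yL := inL _ _ vs vy; split=> //.
rewrite [X in _ - X]ind0 // subr0 !ind1 //.
(* Opening [y] joins the path from [o] inside [s'] to the revealed path from [y] out of [L], so [y]
   is pivotal. *)
have [a [b [ya ab bL]]] := sG _ yL ys.
exists a, b; split=> //; apply: (@reach_trans _ _ _ _ y).
  apply: reach_step vy _; last by rewrite updE yL.
  by apply: reach_mono ov => u /andP[us /upd_true ->]; rewrite sL.
apply: reach_mono ya => u /and3P[-> us wu] /=.
by apply: upd_true; rewrite e.
Qed.

End DuminilCopinTassion.

(** * Simon's inequality *)

Section Simon.
Variables (V : eqType) (R : realType) (nb : V -> seq V) (o : V).
Let adj : rel V := fun x y => y \in nb x.
Implicit Types (p u : R) (s S L : seq V) (w : V -> bool).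

(* Explore the open cluster C of o in S. A path from o out of L last leaves C at
   some y outside S, and what follows y avoids all explored vertices. *)
Lemma simon p L S u w : 0 <= p <= 1 -> uniq L -> uniq S -> o \in S ->
  {subset S <= L} -> {subset outer_boundary nb S <= L} ->
  (forall y, y \in outer_boundary nb S -> bexp p L (ind R (exits adj L ^~ y)) w <= u) ->
  bexp p L (ind R (exits adj L ^~ o)) w <= u * bexp p S (touched R nb o S) w.
Proof.
move=> p01 uL uS oS SL bL Hu.
pose U y := bexp p L (ind R (exits adj L ^~ y)) w.
pose g w := \sum_(y <- outer_boundary nb S) U y * ind R (touches adj S o y) w.
apply: (@le_trans _ _ (bexp p L g w)); last first.
  rewrite /g bexp_sum (_ : bexp p S _ _ = bexp p L (touched R nb o S) w); last first.
    by apply/esym/bexp_dep => //; exact: touched_dep.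
  rewrite /touched bexp_sum mulr_sumr big_seq [leRHS]big_seq.
  apply: ler_sum => y yb; rewrite bexpZ; apply: ler_wpM2r; last exact: Hu.
  rewrite -(bexp_cst p L 0 w); apply: le_bexp => // w' _; exact: ind_ge0.
(* [C] is the revealed part of the open cluster of [o] in [S]; by [I], every revealed vertex is in
   [S] and every revealed open vertex is in [C]. *)
pose C s w := reach adj (fun v => [&& v \in S, v \notin s & w v]) o.
pose I s w := {subset s <= L} /\
  forall v, v \in L -> v \notin s -> v \in S /\ (w v -> C s w v).
have step s' w' y b v : uniq s' -> y \in s' -> C s' w' v -> C (rem y s') (upd w' y b) v.
  move=> us ys; apply: reach_mono => z /and3P[-> zs wz] /=.
  rewrite (contra _ zs) /=; last exact: mem_rem.
  by rewrite /upd; case: eqP zs => // ->; rewrite ys.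
apply: (bexp_explore (I := I)) => // [s' w' us' [sL sC]|]; last first.
  by split=> // v ->.
have [[y [ys yS [v Cv vy]]]|noC] := pselect (exists y,
    [/\ y \in s', y \in S & exists2 v, C s' w' v & adj v y]).
  right; exists y => // b; split=> [z /mem_rem|z zL]; first exact: sL.
  rewrite mem_rem_uniq // inE negb_and negbK => /orP[/eqP ->|zs].
    split=> //; rewrite updE => bT; apply: reach_step (step _ _ _ b _ us' ys Cv) vy _.
    by rewrite yS mem_rem_uniq // inE eqxx updE bT.
  have [zS zC] := sC z zL zs; split=> //.
  rewrite /upd; case: eqP zs => [->|_ zs wz]; first by rewrite ys.
  by apply: step => //; exact: zC.
left.
(* [tau y] is fixed by the revealed states, while [B y] depends only on the unrevealed ones; this
   independence yields the products [t y * U y]. *)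
pose tau y := exists2 v, C s' w' v & adj v y.
pose B y w'' := leaves adj (fun v => (v \in s') && w'' v) L y.
pose t y : R := (`[< tau y >])%:R.
apply: (@le_trans _ _ (bexp p s' (fun w'' =>
    \sum_(y <- outer_boundary nb S) t y * ind R (B y) w'') w')).
  apply: le_bexp => // w'' e.
  have [|nex] := pselect (exits adj L w'' o); last first.
    by rewrite ind0 //; apply: sumr_ge0 => y _; rewrite mulr_ge0 ?ler0n ?ind_ge0.
  move=> ex; rewrite ind1 //; have [a [z [oa az zL]]] := ex.
  have CS v : C s' w' v -> v \in S by move=> /reach_ok[->|/and3P[]].
  have dich v : reach adj (fun v => (v \in L) && w'' v) o v -> C s' w' v \/
      exists y, [/\ y \in outer_boundary nb S, tau y &
                    reach adj (fun v => (v \in s') && w'' v) y v].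
    elim=> [|x v' _ IH xv' /andP[vL wv]]; first by left; exact: reach_refl.
    have [vs|vs] := boolP (v' \in s'); last first.
      by left; apply: (sC v' vL vs).2; rewrite -e.
    right; case: IH => [Cx|[y [yb ty yx]]]; last first.
      by exists y; split=> //; apply: reach_step yx xv' _; rewrite vs.
    exists v'; split; [|by exists x|exact: reach_refl].
    apply: (outer_boundaryP (CS _ Cx) xv'); apply/negP => vS.
    by apply: noC; exists v'; split=> //; exists x.
  (* If the path is still in the cluster at its last vertex [a], then [z] is in the outer boundary
     of [S], hence in [L], a contradiction. *)
  have [Ca|[y [yb ty ya]]] := dich a oa.
    have zb : z \in outer_boundary nb S.
      apply: (outer_boundaryP (CS _ Ca) az); apply: contra zL; exact: SL.
    by rewrite bL in zL.
  rewrite (big_rem _ yb) /= /t asboolT // mul1r ind1; last by exists a, z.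
  by rewrite lerDl; apply: sumr_ge0 => x _; rewrite mulr_ge0 ?ler0n ?ind_ge0.
rewrite bexp_sum.
apply: (@le_trans _ _ (\sum_(y <- outer_boundary nb S) t y * U y)).
  apply: ler_sum => y _; rewrite bexpZ; apply: ler_wpM2l; first exact: ler0n.
  have dB : dep s' (ind R (B y)).
    apply: dep_ind => w1 w2 e; apply: leaves_mono => v /andP[vs].
    by rewrite e // vs.
  rewrite -(bexp_dep p w w' uL us' sL dB); apply: le_bexp => // w'' _.
  by apply: ind_le; apply: leaves_mono => v /andP[/sL -> ->].
rewrite -(bexp_cst p s' (\sum_(y <- _) _) w'); apply: le_bexp => // w'' e.
apply: ler_sum => y _; rewrite mulrC; apply: ler_wpM2l.
  rewrite -(bexp_cst p L 0 w); apply: le_bexp => // ? _; exact: ind_ge0.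
rewrite /t; have [ty|nty] := pselect (tau y); last by rewrite asboolF // ind_ge0.
rewrite asboolT // ind1 //; have [v Cv vy] := ty; exists v => //.
by apply: reach_mono Cv => x /and3P[-> xs wx]; rewrite e.
Qed.

End Simon.

(** * The triangular lattice *)

Section Automorphisms.
Variables (V : eqType) (adj : rel V).

Lemma reach_map (h : V -> V) (ok1 ok2 : V -> bool) x y :
  {homo h : x y / adj x y} -> (forall v, ok1 v -> ok2 (h v)) ->
  reach adj ok1 x y -> reach adj ok2 (h x) (h y).
Proof.
move=> ha hok; elim=> [|u v _ IH uv okv]; first exact: reach_refl.
exact: reach_step IH (ha _ _ uv) (hok _ okv).
Qed.

Lemma exits_map (h g : V -> V) s (w : V -> bool) x :
  {homo h : x y / adj x y} -> {homo g : x y / adj x y} -> cancel h g -> cancel g h ->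
  exits adj s (w \o h) x <-> exits adj (map h s) w (h x).
Proof.
move=> ha ga hK gK; have hs v : (h v \in map h s) = (v \in s).
  by rewrite mem_map //; exact: can_inj hK.
split=> -[y [z [xy yz zs]]].
  exists (h y), (h z); rewrite hs; split=> //; last exact: ha.
  by apply: reach_map xy => // v; rewrite hs.
exists (g y), (g z); rewrite -hs gK; split=> //; last exact: ga.
rewrite -[x]hK; apply: reach_map xy => // v.
by rewrite /= -hs gK.
Qed.

End Automorphisms.

Definition tri_dirs : seq (int * int) :=
  [:: (1, 0); (-1, 0); (0, 1); (0, -1); (1, 1); (-1, -1)].

Definition tri_nb (u : int * int) := [seq u + d | d <- tri_dirs].

Definition tri : rel (int * int) := fun u v => v \in tri_nb u.

Lemma triE u v : tri u v = (v - u \in tri_dirs).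
Proof.
apply/mapP/idP => [[d dd ->]|vu]; first by rewrite addrC addKr.
by exists (v - u) => //; rewrite addrC subrK.
Qed.

Lemma triP (a b c d : int) : reflect
  ((c = a + 1 /\ d = b) \/ (c = a - 1 /\ d = b) \/
   (c = a /\ d = b + 1) \/ (c = a /\ d = b - 1) \/
   (c = a + 1 /\ d = b + 1) \/ (c = a - 1 /\ d = b - 1))
  (tri (a, b) (c, d)).
Proof.
rewrite triE !inE -!pair_eqE /=.
by apply: (iffP idP) => H; lia.
Qed.

Definition box (n : nat) : seq (int * int) :=
  [seq (i, j) | i <- [seq k%:Z - n%:Z | k <- iota 0 (n + n).+1],
                j <- [seq k%:Z - n%:Z | k <- iota 0 (n + n).+1]].

Lemma mem_box n (a b : int) :
  ((a, b) \in box n) = [&& - n%:Z <= a, a <= n%:Z, - n%:Z <= b & b <= n%:Z].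
Proof.
have E (c : int) : (c \in [seq k%:Z - n%:Z | k <- iota 0 (n + n).+1]) =
    (- n%:Z <= c) && (c <= n%:Z).
  apply/mapP/andP => [[k]|[h1 h2]]; first by rewrite mem_iota => ? ->; lia.
  by exists (absz (c + n%:Z)); [rewrite mem_iota|]; lia.
rewrite andbA; apply/allpairsP/idP => [[[i j] /= [hi hj [-> ->]]]|H].
  by move: hi hj; rewrite !E => /andP[-> ->] /andP[-> ->].
by exists (a, b); move: H; rewrite !E /= -andbA => /and3P[-> -> ->].
Qed.

Lemma box_uniq n : uniq (box n).
Proof.
have u : uniq [seq k%:Z - n%:Z | k <- iota 0 (n + n).+1].
  by rewrite map_inj_uniq ?iota_uniq // => i j; lia.
by apply: allpairs_uniq => // -[? ?] [? ?].
Qed.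

Lemma sub_box (s : seq (int * int)) : exists n, {subset s <= box n}.
Proof.
elim: s => [|[a b] s [n IH]]; first by exists 0%N.
exists (n + absz a + absz b)%N => -[c d]; rewrite inE => /predU1P[[-> ->]|/IH];
  rewrite !mem_box; lia.
Qed.

Section TriangularLattice.
Variable R : realType.
Implicit Types (p : R) (n m : nat).

Definition exit_prob p n : R :=
  bexp p (box n) (ind R (exits tri (box n) ^~ 0)) (fun=> false).

Lemma exit_prob_translate p n c w :
  bexp p (map (+%R c) (box n)) (ind R (exits tri (map (+%R c) (box n)) ^~ c)) w =
  exit_prob p n.
Proof.
have tr d : {homo (+%R d) : x y / tri x y}.
  by move=> x y; rewrite !triE opprD addrACA subrr add0r.
have cK : cancel (+%R c) (+%R (- c)) by move=> x; exact: addKr.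
have cK' : cancel (+%R (- c)) (+%R c) by move=> x; exact: addNKr.
rewrite /exit_prob (@eq_bexp_dep _ _ p _ (box n) _ _ (w \o +%R c)); last first.
- by move=> v ->.
- by apply: dep_ind => w1 w2; exact: exits_agree.
rewrite (bexp_map _ _ _ _ (can_inj cK)); congr bexp; apply/funext => w'.
apply: ind_eq; rewrite (exits_map _ _ _ (tr _) (tr _) cK cK').
by rewrite addr0.
Qed.

Lemma exit_prob_le1 p n : 0 <= p <= 1 -> exit_prob p n <= 1.
Proof.
move=> p01; rewrite -(bexp_cst p (box n) 1 (fun=> false)).
by apply: le_bexp => // w _; exact: ind_le1.
Qed.

Lemma exit_prob_ge0 p n : 0 <= p <= 1 -> 0 <= exit_prob p n.
Proof.
move=> p01; rewrite -(bexp_cst p (box n) 0 (fun=> false)).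
by apply: le_bexp => // w _; exact: ind_ge0.
Qed.

(** [m] is chosen so that [S] and its outer boundary lie in [box m]. A path from a boundary vertex
    [y] out of [box n] must leave the translate of [box (n - m)] centred at [y], so [simon] applies
    with [exit_prob p (n - m)] as the uniform bound. *)
Lemma exit_prob_decay p S : 0 <= p <= 1 -> uniq S -> 0 \in S ->
  exists m, forall n, (m <= n)%N ->
    exit_prob p n <= exit_prob p (n - m) *
      bexp p S (touched R tri_nb 0 S) (fun=> false).
Proof.
move=> p01 uS oS; have [m sm] := sub_box (S ++ outer_boundary tri_nb S).
exists m => n mn; have sub : {subset box m <= box n}.
  by move=> [a b]; rewrite !mem_box; lia.
apply: simon => //.
- exact: box_uniq.
- by move=> v vS; apply/sub/sm; rewrite mem_cat vS.
- by move=> v vS; apply/sub/sm; rewrite mem_cat vS orbT.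
move=> y yb; have ym : y \in box m by apply: sm; rewrite mem_cat yb orbT.
pose B := map (+%R y) (box (n - m)).
have Bn : {subset B <= box n}.
  move=> _ /mapP[[a b] ab ->]; case: y ym ab {yb B} => c d.
  by rewrite !mem_box /=; lia.
rewrite -(exit_prob_translate p (n - m) y (fun=> false)) -/B.
rewrite -(@bexp_dep _ _ p (box n) B _ (fun=> false)) //; first last.
- by apply: dep_ind => w1 w2; exact: exits_agree.
- by rewrite map_inj_uniq ?box_uniq //; exact: addrI.
- exact: box_uniq.
apply: le_bexp => // w _; apply: ind_le; apply: exits_sub => //.
by apply/mapP; exists 0; rewrite ?addr0 // mem_box; lia.
Qed.

End TriangularLattice.

(** * The Hex theorem *)

Section Hex.
Variable n : nat.

Definition rhombus : seq (int * int) :=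
  [seq (i%:Z, j%:Z) | i <- iota 1 n, j <- iota 1 n].

Lemma mem_rhombus (a b : int) :
  ((a, b) \in rhombus) = [&& 1 <= a, a <= n%:Z, 1 <= b & b <= n%:Z].
Proof.
apply/allpairsP/idP => [[[i j] /= [hi hj [-> ->]]]|H].
  by move: hi hj; rewrite !mem_iota; lia.
by exists (absz a, absz b); rewrite /= !mem_iota; split; [lia|lia|congr pair; lia].
Qed.

Lemma rhombus_uniq : uniq rhombus.
Proof.
apply: allpairs_uniq; rewrite ?iota_uniq // => -[i j] [i' j'] _ _ /= [h1 h2].
by congr pair; lia.
Qed.

(** The path starts on the column just left of the rhombus, corners of the frame included, which
    [reach] permits at a start. *)
Definition crossing (w : int * int -> bool) := exists k j : nat,
  (k <= n.+1)%N /\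
  reach tri (fun v => (v \in rhombus) && w v) (0, k%:Z) (n%:Z, j%:Z).

Definition swap (v : int * int) := (v.2, v.1).

Lemma tri_swap : {homo swap : x y / tri x y}.
Proof. by move=> [a b] [c d] /triP H; apply/triP => /=; lia. Qed.

Hypothesis n_gt0 : (0 < n)%N.

(* Sperner's lemma modulo 2. The rhombus is surrounded by a frame, of which the
   left side is open and the rest of the bottom side closed; a vertex is labelled
   A if joined to the left side by open vertices and B if joined to the bottom
   side by closed ones. No triangle has an edge AB and an unlabelled vertex, so
   the number of edges AB has the same parity on each row of edges, but it is 1
   at the bottom and 0 at the top. *)
Lemma hex w : crossing w \/ crossing (fun v => ~~ w (swap v)).
Proof.
have [|nLR] := pselect (crossing w); first by left.
right; apply: contrapT => nTB.
pose A v := exists k : nat, (k <= n.+1)%N /\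
  reach tri (fun v => (v \in rhombus) && w v) (0, k%:Z) v.
(* The corner [(0, 0)] is assigned to the left side, whence [0 < k]; the two labels are then
   disjoint. *)
pose B v := exists k : nat, (0 < k <= n.+1)%N /\
  reach tri (fun v => (v \in rhombus) && ~~ w v) (k%:Z, 0) v.
have A1 (x y : int) : A (x, y) -> x = 0 \/ (x, y) \in rhombus /\ w (x, y).
  by move=> [k [_ /reach_ok[[-> _]|/andP[]]]]; [left|right].
have B1 (x y : int) : B (x, y) -> y = 0 /\ x <> 0 \/ (x, y) \in rhombus /\ ~~ w (x, y).
  by move=> [k [k0 /reach_ok[[-> ->]|/andP[]]]]; [left; lia|right].
have A2 (y : nat) : ~ A (n%:Z, y%:Z).
  by move=> [k [kn r]]; apply: nLR; exists k, y.
have B2 (x : nat) : ~ B (x%:Z, n%:Z).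
  move=> [k [/andP[_ kn] r]]; apply: nTB; exists k, x; split=> //.
  apply: (reach_map (h := swap) tri_swap _ r) => -[a b].
  by rewrite /swap /= !mem_rhombus => /andP[H ->]; rewrite andbT; lia.
pose a (v : nat * nat) := `[< A (v.1%:Z, v.2%:Z) >].
pose b (v : nat * nat) := `[< B (v.1%:Z, v.2%:Z) >].
have ab v : ~~ (a v && b v).
  apply/negP => /andP[/asboolP/A1 HA /asboolP/B1 HB].
  case: HA HB => [h|[h wv]] [[h1 h2]|[h3 nw]]; try lia; try by rewrite wv in nw.
    by move: h3; rewrite mem_rhombus; lia.
  by move: h; rewrite mem_rhombus; lia.
pose adjn (u v : nat * nat) := tri (u.1%:Z, u.2%:Z) (v.1%:Z, v.2%:Z).
(* A vertex [x] adjacent to both labels is labelled: by the frame if it is on the left or bottom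
   side, by its own state if it is in the rhombus. On the right or top side, its neighbour [u] or
   [v] would complete a forbidden crossing. *)
have tr u v x : (x.1 <= n.+1)%N -> (x.2 <= n.+1)%N -> adjn u x -> adjn v x ->
    a u -> b v -> a x || b x.
  case: x => x1 x2 /= xn1 xn2 ux vx /asboolP Au /asboolP Bv.
  have [x10|x10] := posnP x1.
    apply/orP; left; apply/asboolP; exists x2; split=> //.
    by rewrite x10; exact: reach_refl.
  have [x20|x20] := posnP x2.
    apply/orP; right; apply/asboolP; exists x1; split; first by lia.
    by rewrite x20; exact: reach_refl.
  have x1n : (x1 <= n)%N.
    rewrite leqNgt; apply/negP => xn.
    have [u1n|h] := eqVneq u.1 n; first by rewrite u1n in Au; exact: A2 Au.
    have [h1|[h1 _]] := A1 _ _ Au; move: ux => /triP /=; try lia.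
    by move: h1; rewrite mem_rhombus; lia.
  have x2n : (x2 <= n)%N.
    rewrite leqNgt; apply/negP => xn.
    have [v2n|h] := eqVneq v.2 n; first by rewrite v2n in Bv; exact: B2 Bv.
    have [[h1 _]|[h1 _]] := B1 _ _ Bv; move: vx => /triP /=; try lia.
    by move: h1; rewrite mem_rhombus; lia.
  have xr : (x1%:Z, x2%:Z) \in rhombus by rewrite mem_rhombus; lia.
  have [wx|wx] := boolP (w (x1%:Z, x2%:Z)); apply/orP.
    left; apply/asboolP; have [k [kn r]] := Au; exists k; split=> //.
    by apply: reach_step r ux _; rewrite xr.
  right; apply/asboolP; have [k [kn r]] := Bv; exists k; split=> //.
  by apply: reach_step r vx _; rewrite xr.
pose e u v := (a u && b v) || (a v && b u).
(* A triangle has an even number of AB edges. *)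
have tri0 u v x : (u.1 <= n.+1)%N -> (u.2 <= n.+1)%N -> (v.1 <= n.+1)%N ->
    (v.2 <= n.+1)%N -> (x.1 <= n.+1)%N -> (x.2 <= n.+1)%N ->
    adjn u v -> adjn v u -> adjn u x -> adjn x u -> adjn v x -> adjn x v ->
    e u v = e v x (+) e u x.
  move=> un1 un2 vn1 vn2 xn1 xn2 uv vu ux xu vx xv; rewrite /e.
  have T y z t : (a y -> b z -> a t || b t) -> a y && b z ==> a t || b t.
    by move=> H; apply/implyP => /andP[]; exact: H.
  have := ab u; have := ab v; have := ab x.
  have := T _ _ _ (tr u v x xn1 xn2 ux vx); have := T _ _ _ (tr v u x xn1 xn2 vx ux).
  have := T _ _ _ (tr u x v vn1 vn2 uv xv); have := T _ _ _ (tr x u v vn1 vn2 xv uv).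
  have := T _ _ _ (tr v x u un1 un2 vu xu); have := T _ _ _ (tr x v u un1 un2 xu vu).
  by case: (a u); case: (b u); case: (a v); case: (b v); case: (a x); case: (b x).
(* The two triangles of a unit cell share the diagonal, which cancels modulo 2. *)
have cell i j : (i <= n)%N -> (j <= n)%N ->
    e (i, j) (i.+1, j) (+) e (i.+1, j) (i.+1, j.+1) =
    e (i, j) (i, j.+1) (+) e (i, j.+1) (i.+1, j.+1).
  move=> hi hj.
  have adj_t (x y x' y' : nat) : (x' = x.+1 /\ y' = y) \/ (x' = x /\ y' = y.+1) \/
      (x' = x.+1 /\ y' = y.+1) -> adjn (x, y) (x', y') /\ adjn (x', y') (x, y).
    by move=> H; split; apply/triP; rewrite /=; lia.
  have [h1 h1'] := adj_t i j i.+1 j ltac:(lia).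
  have [h2 h2'] := adj_t i j i j.+1 ltac:(lia).
  have [h3 h3'] := adj_t i j i.+1 j.+1 ltac:(lia).
  have [h4 h4'] := adj_t i.+1 j i.+1 j.+1 ltac:(lia).
  have [h5 h5'] := adj_t i j.+1 i.+1 j.+1 ltac:(lia).
  have := tri0 (i, j) (i.+1, j) (i.+1, j.+1).
  have := tri0 (i, j) (i, j.+1) (i.+1, j.+1).
  rewrite /= !ltnS hi hj !(leqW hi) !(leqW hj) => H1 H2.
  by rewrite H1 // H2 //; do 3!case: (e _ _).
pose H j := \big[addb/false]_(0 <= i < n.+1) e (i, j) (i.+1, j).
have rowE j m : (j <= n)%N -> (m <= n.+1)%N ->
    (\big[addb/false]_(0 <= i < m) e (i, j) (i.+1, j)) (+) e (m, j) (m, j.+1) =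
    e (0%N, j) (0%N, j.+1) (+) \big[addb/false]_(0 <= i < m) e (i, j.+1) (i.+1, j.+1).
  move=> jn; elim: m => [|m IH] mn; first by rewrite !big_geq // addbF addFb.
  rewrite !big_nat_recr //= -addbA cell // addbA IH ?addbA //; exact: ltnW.
have a0 j : (j <= n.+1)%N -> a (0%N, j).
  by move=> jn; apply/asboolP; exists j; split=> //; exact: reach_refl.
have b0 j : b (0%N, j) = false.
  apply/asboolP => /B1[[]//|[]]; rewrite mem_rhombus /=; lia.
have an j : a (n.+1, j) = false.
  apply/asboolP => /A1[|[]] /=; first lia.
  by rewrite mem_rhombus /=; lia.
(* The edges joining consecutive rows at columns 0 and [n.+1] are not AB: the first column carries
   no B, the last no A. *)
have HS j : (j <= n)%N -> H j = H j.+1.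
  move=> jn; have := rowE j n.+1 jn (leqnn _).
  by rewrite /e !an !b0 /= !andbF !addbF.
have HE j : (j <= n.+1)%N -> H j = H 0%N.
  by elim: j => // j IH jn; rewrite -HS // IH // ltnW.
have := HE n.+1 (leqnn _); rewrite /H big1; last first.
  move=> i _; have bn k : b (k, n.+1) = false.
    apply/asboolP => /B1[|[]] /=; first lia.
    by rewrite mem_rhombus /=; lia.
  by rewrite /e !bn !andbF.
rewrite big_nat_recl // big1 /=; last first.
  move=> i _; rewrite /e.
  have ai k : a (k.+1, 0%N) = false.
    apply/asboolP => /A1[|[]] /=; first lia.
    by rewrite mem_rhombus /=; lia.
  by rewrite !ai.
have b1 : b (1%N, 0%N) by apply/asboolP; exists 1%N; split=> //; exact: reach_refl.
by rewrite /e a0 // b1.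
Qed.

End Hex.

(** * Percolation on the triangular lattice above density 1/2 *)

Section TriangularCriticality.
Variable R : realType.
Implicit Types (p : R) (n m : nat).

(** By [hex], a crossing by open sites or the reflected crossing by closed sites occurs. At density
    1/2 both have the same probability, by the symmetries [swap] and open/closed. *)
Lemma crossing_half n : (0 < n)%N ->
  1 / 2 <= bexp (1 / 2 : R) (rhombus n) (ind R (crossing n)) (fun=> false).
Proof.
move=> n0; set D := rhombus n; have uD : uniq D := rhombus_uniq n.
have p01 : 0 <= (1 / 2 : R) <= 1 by lra.
have dc : dep D (ind R (crossing n)).
  apply: dep_ind => w1 w2 e [k [j [kn r]]]; exists k, j; split=> //.
  by apply: reach_mono r => v /andP[vD]; rewrite e // vD.
pose g w := ind R (crossing n) (fun v => ~~ w (swap v)).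
have : bexp (1 / 2) D (fun w => ind R (crossing n) w + g w) (fun=> false) >= 1.
  rewrite -[leLHS](bexp_cst (1 / 2) D 1 (fun=> false)); apply: le_bexp => // w _.
  have [cr|cr] := hex n0 w.
    by rewrite (ind1 _ cr) lerDl ind_ge0.
  by rewrite /g (ind1 _ cr) lerDr ind_ge0.
have swapK : cancel swap swap by move=> [].
have -> : bexp (1 / 2) D (fun w => ind R (crossing n) w + g w) (fun=> false) =
  bexp (1 / 2) D (ind R (crossing n)) (fun=> false) +
  bexp (1 / 2) D (ind R (crossing n)) (fun=> false).
  rewrite bexpD; congr (_ + _).
  have e : perm_eq D (map swap D).
    apply: uniq_perm; rewrite ?map_inj_uniq //; first exact: can_inj swapK.
    move=> [x y]; rewrite -[(x, y) in RHS]/(swap (y, x)).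
    rewrite mem_map; last exact: can_inj swapK.
    by rewrite !mem_rhombus; lia.
  rewrite (bexp_perm _ _ _ uD e).
  rewrite -(bexp_map (1 / 2) D (fun w => ind R (crossing n) (fun v => ~~ w v)) _
     (can_inj swapK)).
  rewrite [RHS]bexp_flip; apply: (@eq_bexp_dep _ _ _ _ D) => [|v ->//].
  by move=> w1 w2 e'; apply: dc => v vD; rewrite e'.
lra.
Qed.

(** Union bound: a crossing of the rhombus of side [n.+1] starts at one of [n.+3] sites and, having
    to reach horizontal distance [n.+1], leaves the box of radius [n] around its start. *)
Lemma exit_prob_half n : 1 / 2 <= n.+3%:R * exit_prob (1 / 2 : R) n.
Proof.
have p01 : 0 <= (1 / 2 : R) <= 1 by lra.
apply: le_trans (crossing_half (ltn0Sn n)) _.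
pose L := box (n + n + 3).
pose c (k : 'I_n.+3) : int * int := (0, (val k)%:Z).
pose B k := map (+%R (c k)) (box n).
have uB k : uniq (B k) by rewrite map_inj_uniq ?box_uniq //; exact: addrI.
have BL k : {subset B k <= L}.
  move=> _ /mapP[[a b] ab ->]; move: ab; rewrite !mem_box /=.
  by have := ltn_ord k; lia.
have DL : {subset rhombus n.+1 <= L}.
  by move=> [a b]; rewrite mem_rhombus mem_box; lia.
have dc : dep (rhombus n.+1) (ind R (crossing n.+1)).
  apply: dep_ind => w1 w2 e [k [j [kn r]]]; exists k, j; split=> //.
  by apply: reach_mono r => v /andP[vD]; rewrite e // vD.
rewrite -(bexp_dep _ (fun=> false) _ (box_uniq _) (rhombus_uniq _) DL dc).
apply: (@le_trans _ _ (\sum_(k < n.+3)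
    bexp (1 / 2) L (ind R (exits tri (B k) ^~ (c k))) (fun=> false))).
  rewrite -bexp_sum; apply: le_bexp => // w _.
  have [cr|ncr] := pselect (crossing n.+1 w); last first.
    by rewrite ind0 //; apply: sumr_ge0 => k _; exact: ind_ge0.
  rewrite ind1 //; have [k [j [kn r]]] := cr.
  pose k' : 'I_n.+3 := Ordinal (ltac:(lia) : (k < n.+3)%N).
  have ex : exits tri (B k') w (c k').
    have ck : c k' \in B k'.
      by apply/mapP; exists 0; rewrite ?addr0 // mem_box; lia.
    have [[_ /mapP[[a b]]]|] := reach_cut r ck; last first.
      by apply: leaves_mono => v /and3P[-> _ ->].
    rewrite mem_box => ab [e1 e2]; lia.
  rewrite (bigD1 k') //= ind1 // lerDl.
  by apply: sumr_ge0 => i _; exact: ind_ge0.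
rewrite (eq_bigr (fun=> exit_prob (1 / 2) n)); last first.
  move=> k _; rewrite -(exit_prob_translate (1 / 2) n (c k) (fun=> false)).
  apply: bexp_dep (box_uniq _) (uB k) (BL k) _.
  by apply: dep_ind => w1 w2; exact: exits_agree.
by rewrite sumr_const card_ord mulr_natl.
Qed.

(** Bernoulli's inequality bounds [a ^+ j] by [1 / (1 + j * h)] with [h = 1 - a]. Squaring it, that
    is taking [k = j + j], gives quadratic decay, which beats the linear factor. *)
Lemma linear_geometric (a : R) (m : nat) : 0 <= a -> a < 1 ->
  exists k, (k * m + 3)%:R * a ^+ k < 1 / 2.
Proof.
move=> a0 a1; have [h hE] : exists h, h = 1 - a by exists (1 - a).
have h0 : 0 < h by lra.
have bern k : (1 + k%:R * h) * a ^+ k <= 1.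
  elim: k => [|k IH]; first by rewrite mul0r addr0 expr0 mulr1.
  have ak1 : a ^+ k <= 1 by apply: exprn_ile1 => //; exact: ltW.
  have ak0 : 0 <= a ^+ k by exact: exprn_ge0.
  have h1 : 0 <= a * (1 - (1 + k%:R * h) * a ^+ k) by apply: mulr_ge0 => //; lra.
  have h2 : 0 <= a * h * (1 - a ^+ k) by rewrite !mulr_ge0 //; lra.
  have h3 : 0 <= h ^+ 2 by exact: sqr_ge0.
  rewrite exprS -[k.+1%:R]natr1.
  by move: (a ^+ k) (k%:R : R) h1 h2 => X K h1 h2; subst h; lra.
(* With this [j], [(j * h) ^+ 2] exceeds [j * (4 * m + 6)], which is at least twice
   [(j + j) * m + 3]. *)
pose j := Num.bound ((4 * m%:R + 6) / h ^+ 2).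
have hj : (4 * m%:R + 6) / h ^+ 2 < j%:R.
  by apply/archi_boundP/divr_ge0; rewrite ?sqr_ge0 //; lra.
have hj2 : 4 * m%:R + 6 < j%:R * h ^+ 2 by rewrite -ltr_pdivrMr // exprn_gt0.
have m0 : 0 <= m%:R :> R by exact: ler0n.
have j0 : 0 <= j%:R :> R by exact: ler0n.
have j1 : 1 <= j%:R :> R.
  by rewrite ler1n lt0n; apply/eqP => e; move: hj2; rewrite e mul0r; lra.
exists (j + j)%N; rewrite exprD natrD natrM natrD.
have := bern j; have ak0 : 0 <= a ^+ j by exact: exprn_ge0.
set x := a ^+ j in ak0 *; set J : R := j%:R in hj2 j0 j1 *.
move: (m%:R : R) m0 hj2 => M M0 hj2 b.
have e1 : ((1 + J * h) * x) ^+ 2 <= 1.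
  apply: exprn_ile1 => //; apply: mulr_ge0 => //.
  by rewrite addr_ge0 // mulr_ge0 // ltW.
have e2 : 2 * ((J + J) * M + 3) + 1 <= (1 + J * h) ^+ 2.
  have : J * (4 * M + 6) <= J * (J * h ^+ 2) by apply: ler_wpM2l => //; exact: ltW.
  nra.
have e3 : (2 * ((J + J) * M + 3) + 1) * x ^+ 2 <= 1.
  apply: le_trans e1; rewrite exprMn; apply: ler_wpM2r => //; exact: sqr_ge0.
have [->|xn0] := eqVneq x 0; first by rewrite !mulr0; lra.
have x2 : 0 < x ^+ 2 by rewrite exprn_even_gt0.
rewrite -expr2; nra.
Qed.

(** A value [a < 1] would give [exit_prob] at most [a ^+ k] at radius [k * m], against the bound of
    order 1/n from [exit_prob_half]. *)
Lemma touched_half S w : uniq S -> 0 \in S ->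
  1 <= bexp (1 / 2 : R) S (touched R tri_nb 0 S) w.
Proof.
move=> uS oS; have p01 : 0 <= (1 / 2 : R) <= 1 by lra.
rewrite (@eq_bexp_dep _ _ _ _ S _ _ (fun=> false)); last first.
- by move=> v ->.
- exact: touched_dep.
set a := bexp _ _ _ _; rewrite leNgt; apply/negP => a1.
have a0 : 0 <= a.
  rewrite -(bexp_cst (1 / 2) S 0 (fun=> false)); apply: le_bexp => // w' _.
  by apply: sumr_ge0 => y _; exact: ind_ge0.
have [m Hm] := exit_prob_decay p01 uS oS.
have dec k : exit_prob (1 / 2 : R) (k * m) <= a ^+ k.
  elim: k => [|k IH]; first by rewrite expr0 exit_prob_le1.
  rewrite exprSr; apply: le_trans (Hm _ _) _; first by rewrite mulSn leq_addr.
  by rewrite mulSn addKn; apply: ler_wpM2r.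
have [k hk] := linear_geometric m a0 a1.
have := exit_prob_half (k * m); rewrite leNgt => /negP; apply.
apply: le_lt_trans hk; rewrite addn3; apply: ler_wpM2l => //; exact: ler0n.
Qed.

(** With t the probability at 51/100, the mean value bound between 1/2 and 51/100 gives (1 - t) /
    100 <= t, that is t >= 1/101. *)
Lemma exit_prob_lower n : 1 / 101 <= exit_prob (51 / 100 : R) n.
Proof.
have := @bexp_mean_value _ R (1 / 2) (51 / 100) (box n)
  (ind R (exits tri (box n) ^~ 0)) (fun=> false).
rewrite -/(exit_prob _ n) => H.
have {H}: (51 / 100 - 1 / 2) * (1 - exit_prob (51 / 100 : R) n) <=
    exit_prob (51 / 100) n - exit_prob (1 / 2) n.
  apply: H; [lra|lra|lra|exact: box_uniq| | |].
  - by apply: incr_ind => w1 w2; exact: exits_incr.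
  - by move=> w; exact: ind_le1.
  move=> p /andP[p0 p1]; have p01 : 0 <= p <= 1 by lra.
  apply: pivotal_bound => //; [exact: box_uniq|by rewrite mem_box; lia|].
  move=> S w uS oS; apply: le_trans (touched_half w uS oS) _.
  by apply: bexp_incr_param; [lra|lra|lra|exact: touched_incr].
have : 0 <= exit_prob (1 / 2 : R) n by apply: exit_prob_ge0; lra.
lra.
Qed.

End TriangularCriticality.

(** * Lifting percolation along a projection *)

Section Lifting.
Variables (V W : eqType) (R : realType) (adjV : rel V) (adjW : rel W) (proj : W -> V).
Hypothesis lift2 : forall l y, adjV (proj l) y -> exists l1 l2,
  [/\ l1 != l2, adjW l l1, adjW l l2, proj l1 = y & proj l2 = y].

Definition leaves_over (L : seq V) (l0 : W) (w : W -> bool) :=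
  exists l z, [/\ reach adjW w l0 l, adjV (proj l) z & z \notin L].

Lemma leaves_over_incr L l0 : incr (ind R (leaves_over L l0)).
Proof.
apply: incr_ind => w1 w2 le [l [z [r lz zL]]]; exists l, z; split=> //.
exact: reach_mono r.
Qed.

(* Explore the cluster of proj l0, maintaining over each of its vertices a vertex
   in the cluster of l0. When y is explored from proj l, the two neighbours of l
   above y are unexplored and at least one of them is open with probability
   1 - (1 - p)^2. *)
Lemma lift_exploration (p : R) (L s : seq V) (l0 : W) (w : V -> bool)
    (w' : W -> bool) : 0 <= p <= 1 ->
  uniq s -> {subset s <= L} ->
  (forall v, v \in L -> v \notin s -> w v ->
    exists2 l, proj l = v & reach adjW w' l0 l) ->
  (forall l, proj l \in s -> w' l = false) ->
  exists s', [/\ uniq s', forall l, l \in s' -> proj l \in s &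
    bexp (1 - (1 - p) ^+ 2) s (ind R (exits adjV L ^~ (proj l0))) w <=
    bexp p s' (ind R (leaves_over L l0)) w'].
Proof.
move=> p01; have q01 : 0 <= 1 - (1 - p) ^+ 2 <= 1 by nra.
have [n] := ubnP (size s); elim: n s w w' => // n IH s w w'.
rewrite ltnS => sn us sL sC w'F.
pose C x := x = proj l0 \/ [/\ x \in L, x \notin s & w x].
have CE x : C x -> exists2 l, proj l = x & reach adjW w' l0 l.
  by move=> [->|[xL xs wx]]; [exists l0 => //; exact: reach_refl|exact: sC].
(* With no unrevealed neighbour of the cluster left, either [leaves_over] already holds or [exits]
   fails. *)
have [[y ys [x Cx xy]]|noC] := pselect (exists2 y, y \in s & exists2 x, C x & adjV x y);
    last first.
  exists [::]; split=> //=.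
  have [far|nfar] := pselect (leaves_over L l0 w').
    rewrite ind1 // -[leRHS](bexp_cst (1 - (1 - p) ^+ 2) s 1 w).
    by apply: le_bexp => // ? _; exact: ind_le1.
  rewrite ind0 // -[leRHS](bexp_cst (1 - (1 - p) ^+ 2) s 0 w).
  apply: le_bexp => // w'' e; rewrite ind0 // => -[a [z [oa az zL]]]; apply: nfar.
  suff /CE[l la l0l] : C a by exists l, z; rewrite la.
  elim: oa {az} => [|u v _ Cu uv /andP[vL wv]]; first by left.
  right; split=> //; first by apply/negP => vs; apply: noC; exists v => //; exists u.
  rewrite -e //; apply/negP => vs; apply: noC; exists v => //; exists u => //.
have [l lx l0l] := CE x Cx; rewrite -lx in xy.
have [l1 [l2 [l12 ll1 ll2 l1y l2y]]] := lift2 xy.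
have srem : (size (rem y s) < n)%N.
  by rewrite size_rem //; case: s ys sn {us sL sC w'F C Cx CE}.
have urem : uniq (rem y s) by exact: rem_uniq.
have Lrem : {subset rem y s <= L} by move=> v /mem_rem; exact: sL.
have nyr : y \notin rem y s by rewrite mem_rem_uniq // inE eqxx.
have F1 l' : proj l' = y ->
    forall l'', proj l'' \in rem y s -> upd w' l' true l'' = false.
  move=> l'y l'' h; rewrite /upd; case: eqP => [e|_].
    by move: h; rewrite e l'y (negPf nyr).
  by apply: w'F; exact: mem_rem h.
have F0 l'' : proj l'' \in rem y s -> w' l'' = false.
  by move=> h; apply: w'F; exact: mem_rem h.
have upd_le l' : le_config w' (upd w' l' true) by move=> v; rewrite /upd; case: eqP.
have inv l' (b : bool) w2 :
    (b -> proj l' = y /\ reach adjW w2 l0 l') -> le_config w' w2 ->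
    forall v, v \in L -> v \notin rem y s -> upd w y b v ->
    exists2 l, proj l = v & reach adjW w2 l0 l.
  move=> hb le v vL; rewrite mem_rem_uniq // inE negb_and negbK /upd.
  case: eqP => [-> _ /hb[h1 h2]|_ /= vs wv]; first by exists l'.
  by have [l3 l3v r] := sC v vL vs wv; exists l3 => //; exact: reach_mono r.
have reach1 l' : adjW l l' -> reach adjW (upd w' l' true) l0 l'.
  move=> ll'; apply: (reach_step (y := l)) => //; last by rewrite updE.
  exact: reach_mono (upd_le _) l0l.
(* Three branches: [l1] open; [l1] closed and [l2] open; both closed. In the first two, [y] counts
   as open, with total weight [p + (1 - p) * p]. *)
have [s1 [u1 p1 E1]] := IH _ (upd w y true) _ srem urem Lrem
  (inv l1 true _ (fun _ => conj l1y (reach1 _ ll1)) (upd_le _)) (F1 _ l1y).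
have [s2 [u2 p2 E2]] := IH _ (upd w y true) _ srem urem Lrem
  (inv l2 true _ (fun _ => conj l2y (reach1 _ ll2)) (upd_le _)) (F1 _ l2y).
have [s3 [u3 p3 E3]] := IH _ (upd w y false) w' srem urem Lrem
  (inv l1 false w' (fun h => False_ind _ (notF h)) (fun _ => id)) F0.
(* The branches may require different sites; [bexp_sub] lets all of them use the union, as the event
   is increasing and the extra sites are closed by default. *)
pose t := undup (s1 ++ s2 ++ s3).
have pt v : v \in t -> proj v \in rem y s.
  by rewrite mem_undup !mem_cat => /or3P[/p1|/p2|/p3].
have l1t : l1 \notin t by apply: contra nyr => /pt; rewrite l1y.
have l2t : l2 \notin t by apply: contra nyr => /pt; rewrite l2y.
exists [:: l1, l2 & t]; split.
- by rewrite /= inE negb_or l12 l1t l2t undup_uniq.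
- by move=> v; rewrite !inE => /or3P[/eqP ->|/eqP ->|/pt/mem_rem //];
    rewrite ?l1y ?l2y.
have fi := leaves_over_incr L l0.
have l1F : w' l1 = false by apply: w'F; rewrite l1y.
have l2F : w' l2 = false by apply: w'F; rewrite l2y.
have ut : uniq t := undup_uniq _.
have G1 : bexp p s1 (ind R (leaves_over L l0)) (upd w' l1 true) <=
    bexp p (l2 :: t) (ind R (leaves_over L l0)) (upd w' l1 true).
  apply: bexp_sub => //; first by rewrite /= l2t.
    by move=> v v1; rewrite inE mem_undup mem_cat v1 orbT.
  move=> v; rewrite inE => /predU1P[->|/pt vt] _; last exact: (F1 _ l1y).
  by rewrite /upd eq_sym (negPf l12).
have G2 : bexp p s2 (ind R (leaves_over L l0)) (upd w' l2 true) <=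
    bexp p t (ind R (leaves_over L l0)) (upd w' l2 true).
  apply: bexp_sub => // [v v2|v /pt vt _]; last exact: (F1 _ l2y).
  by rewrite mem_undup !mem_cat v2 orbT.
have G3 : bexp p s3 (ind R (leaves_over L l0)) w' <=
    bexp p t (ind R (leaves_over L l0)) w'.
  apply: bexp_sub => // [v v2|v /pt vt _]; last exact: F0.
  by rewrite mem_undup !mem_cat v2 !orbT.
rewrite (bexp_pick _ _ _ us ys) [leRHS]/= (upd_id l1F) (upd_id l2F).
move: G1; rewrite /=.
move: E1 E2 E3 G2 G3.
set X1 := bexp _ _ _ (upd w y true); set X0 := bexp _ _ _ (upd w y false).
move=> E1 E2 E3 G2 G3 G1.
have H1 := le_trans E1 G1; have H2 := le_trans E2 G2; have H3 := le_trans E3 G3.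
case/andP: p01 => p0 p1'.
have K1 := ler_wpM2l p0 H1; have K2 := ler_wpM2l p0 H2.
have p1'' : 0 <= 1 - p by lra.
have K3 := ler_wpM2l p1'' H3; have K4 := ler_wpM2l p1'' (lerD K2 K3).
lra.
Qed.

End Lifting.

(** * Events of the configuration space *)

Section ConfigurationEvents.
Variables (V : countType) (R : realType).
Implicit Types (P : (V -> bool) -> Prop) (s t : seq V).

Definition event P := measurable ([set w | P w] : set (configuration V)).

Lemma event_eq P Q : (forall w, P w <-> Q w) -> event P -> event Q.
Proof.
move=> PQ; rewrite /event (_ : [set w | P w] = [set w | Q w]) //.
by apply/seteqP; split=> w /=; apply PQ.
Qed.

Lemma event_open v : event (fun w => w v).
Proof. by apply: sub_sigma_algebra; exists v. Qed.

Lemma event_cst (Q : Prop) : event (fun=> Q).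
Proof.
rewrite /event; have [q|q] := pselect Q.
  by rewrite (_ : [set _ | _] = setT) //; apply/seteqP; split.
by rewrite (_ : [set _ | _] = set0) //; apply/seteqP; split.
Qed.

Lemma event_not P : event P -> event (fun w => ~ P w).
Proof. exact: measurableC. Qed.

Lemma event_and P Q : event P -> event Q -> event (fun w => P w /\ Q w).
Proof. exact: measurableI. Qed.

Lemma event_or P Q : event P -> event Q -> event (fun w => P w \/ Q w).
Proof. exact: measurableU. Qed.

Lemma event_exists (I : countType) (P : I -> (V -> bool) -> Prop) :
  (forall i, event (P i)) -> event (fun w => exists i, P i w).
Proof.
move=> mP; rewrite /event (_ : [set w | _] = \bigcup_i [set w | P i w]).
  exact: countable_bigcupT_measurable.
by apply/seteqP; split=> w /= => [[i Pi]|[i _ Pi]]; exists i.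
Qed.

Lemma event_forall (I : countType) (P : I -> (V -> bool) -> Prop) :
  (forall i, event (P i)) -> event (fun w => forall i, P i w).
Proof.
move=> mP; apply: (@event_eq (fun w => ~ exists i, ~ P i w)).
  by move=> w; split=> [H i|H [i]//]; apply: contrapT => nP; apply: H; exists i.
by apply: event_not; apply: event_exists => i; exact: event_not.
Qed.

Lemma event_all s : event (fun w => all w s).
Proof.
elim: s => [|v s IH]; first exact: (event_cst true).
apply: (event_eq _ (event_and (event_open v) IH)) => w /=.
by split=> [[-> ->]|/andP].
Qed.

Lemma event_cluster (adj : rel V) x y : event (fun w => open_cluster adj w x y).
Proof.
apply: (@event_eq (fun w => exists s,
    (path adj x s /\ last x s = y) /\ all w (x :: s))).
  by move=> w; split=> -[s]; [case=> -[]|case]; exists s.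
by apply: event_exists => s; apply: event_and; [exact: event_cst|exact: event_all].
Qed.

(** A cluster is infinite when no finite list contains it, and there are only countably many
    lists. *)
Lemma event_percolation (adj : rel V) : event (percolation adj).
Proof.
apply: (@event_eq (fun w => exists x, ~ exists s : seq V, forall y,
    y \in s \/ ~ open_cluster adj w x y)).
  move=> w; split=> -[x inf]; exists x.
    apply: contra_not inf => /finite_seqP[s e]; exists s => y.
    have [ys|ys] := boolP (y \in s); [by left|right].
    by rewrite e /=; apply/negP.
  apply: contra_not inf => -[s H]; apply: (@sub_finite_set _ _ [set` s]).
    by move=> y cy; have [|] := H y.
  exact: finite_seq.
apply: event_exists => x; apply: event_not; apply: event_exists => s.
apply: event_forall => y.
apply: event_or; first exact: event_cst.
by apply: event_not; exact: event_cluster.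
Qed.

Lemma bernoulli_product_bexp (p : R) s t P w0 : 0 <= p <= 1 ->
  uniq (s ++ t) -> dep (s ++ t) (fun w => `[< P w >]) ->
  event (fun w : V -> bool => {in t, w =1 w0} /\ P w) /\
  bernoulli_product V p [set w : configuration V | {in t, w =1 w0} /\ P w] =
  ((\prod_(v <- t) (if w0 v then p else 1 - p)) * bexp p s (ind R P) w0)%:E.
Proof.
move=> p01; elim: s t w0 => [|x s IH] t w0 => [ut dP|/andP[xst ust] dP].
  have cyl : event (fun w : V -> bool => {in t, w =1 w0}).
    apply: (@event_eq (fun w => forall v, v \notin t \/ (w v <-> w0 v))).
      move=> w; split=> [H v vt|H v].
        by have [|e] := H v; [rewrite vt|apply/idP/idP => /e].
      by have [vt|] := boolP (v \in t); [right; rewrite H|left].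
    apply: event_forall => v; apply: event_or; first exact: event_cst.
    have [wv|wv] := boolP (w0 v).
      apply: (event_eq _ (event_open v)) => w.
      by split=> [|[_ ->]].
    apply: (event_eq _ (event_not (event_open v))) => w.
    by split=> [nw|[h _] /h //]; split.
  have PE (w : V -> bool) : {in t, w =1 w0} -> P w <-> P w0.
    move=> e; have /= h := dP _ _ e.
    by split=> /asboolP; [rewrite h|rewrite -h] => /asboolP.
  have [P0|P0] := pselect (P w0).
    rewrite [bexp _ _ _ _]ind1 // mulr1 -bernoulli_productE //.
    have e : [set w : configuration V | {in t, w =1 w0} /\ P w] =
        [set w : configuration V | forall v, v \in t -> w v = w0 v].
      apply/seteqP; split=> w /=; first by case.
      by move=> h; split=> //; apply/PE.
    by rewrite /event e.
  rewrite [bexp _ _ _ _]ind0 // mulr0.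
  have e : [set w : configuration V | {in t, w =1 w0} /\ P w] = set0.
    by apply/seteqP; split=> // w [h] /(PE _ h).
  by rewrite /event e measure0; split.
have ux : uniq (s ++ x :: t).
  by rewrite uniq_catC /= mem_cat orbC -mem_cat xst uniq_catC.
have dx : dep (s ++ x :: t) (fun w => `[< P w >]).
  apply: dep_sub dP => v; rewrite inE !mem_cat inE.
  by move=> /or3P[->|->|->]; rewrite ?orbT.
have [m1 E1] := IH (x :: t) (upd w0 x true) ux dx.
have [m0 E0] := IH (x :: t) (upd w0 x false) ux dx.
have xt : x \notin t by apply: contra xst; rewrite mem_cat => ->; rewrite orbT.
have updt b v : v \in t -> upd w0 x b v = w0 v.
  by move=> vt; rewrite /upd; case: eqP => // vx; move: vt; rewrite vx (negPf xt).
have inb (w : V -> bool) b :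
    {in x :: t, w =1 upd w0 x b} <-> w x = b /\ {in t, w =1 w0}.
  split=> [H|[wx H] v]; first split=> [|v vt].
  - by rewrite H ?mem_head // updE.
  - by rewrite H ?inE ?vt ?orbT // updt.
  by rewrite inE => /predU1P[->|vt]; rewrite ?updE // updt // H.
have e : [set w : configuration V | {in t, w =1 w0} /\ P w] =
    [set w : configuration V | {in x :: t, w =1 upd w0 x true} /\ P w] `|`
    [set w : configuration V | {in x :: t, w =1 upd w0 x false} /\ P w].
  apply/seteqP; split=> w /=.
    by move=> [h Pw]; case wx: (w x); [left|right]; split=> //; apply/inb.
  by move=> [] [/inb[]].
rewrite /event e; split; first exact: measurableU.
rewrite measureU //; last first.
  by apply/seteqP; split=> // w [[/inb[wt _] _] [/inb[]]]; rewrite wt.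
have prodE b : \prod_(v <- t) (if upd w0 x b v then p else 1 - p) =
    \prod_(v <- t) (if w0 v then p else 1 - p).
  by apply: eq_big_seq => v vt; rewrite updt.
apply: (etrans (congr2 (fun a b => (a + b)%E) E1 E0)).
rewrite -EFinD !big_cons !updE !prodE; congr _%:E.
by rewrite /=; ring.
Qed.

End ConfigurationEvents.

(** * The body centered cubic lattice *)

Lemma reach_cluster (V : eqType) (adj : rel V) (w : V -> bool) x y :
  w x -> reach adj w x y -> open_cluster adj w x y.
Proof.
move=> wx; elim=> [|u v _ [s [xs ws <-]] uv wv].
  by exists [::]; split=> //=; rewrite wx.
exists (rcons s v); split; last by rewrite last_rcons.
  by rewrite rcons_path xs.
by rewrite -rcons_cons all_rcons wv.
Qed.

(* The projection along (1, 1, 1): 2e_1, 2e_2 and 2e_3 are sent to (1, 0), (0, 1)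
   and (-1, -1). *)
Definition bcc_proj (l : bcc) : int * int :=
  (((val l).1.1 - (val l).2) %/ 2, ((val l).1.2 - (val l).2) %/ 2)%Z.

Definition bcc_dirs : seq (int * int * int) :=
  [:: (2, 0, 0); (-2, 0, 0); (0, 2, 0); (0, -2, 0); (0, 0, 2); (0, 0, -2);
      (1, 1, 1); (1, 1, -1); (1, -1, 1); (1, -1, -1);
      (-1, 1, 1); (-1, 1, -1); (-1, -1, 1); (-1, -1, -1)].

Lemma in_bccE (x y z : int) : in_bcc (x, y, z) = (2 %| x - y)%Z && (2 %| x - z)%Z.
Proof. rewrite /in_bcc /in_2Z3 /=; lia. Qed.

Lemma bcc_step (l : bcc) (a b c : int) :
  (- a, - b, - c) \in bcc_dirs -> (2 %| a - b)%Z -> (2 %| a - c)%Z ->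
  exists2 l', bcc_adj l l' & val l' = val l + (a, b, c).
Proof.
move=> abc ab ac; have H : in_bcc (val l + (a, b, c)).
  case: l => [[[x y] z] /= h]; move: h; rewrite !in_bccE /=; lia.
exists (Sub (val l + (a, b, c)) H); last by rewrite SubK.
by rewrite /bcc_adj SubK opprD addrA subrr add0r.
Qed.

Lemma bcc_lift2 (l : bcc) y : tri (bcc_proj l) y -> exists l1 l2,
  [/\ l1 != l2, bcc_adj l l1, bcc_adj l l2, bcc_proj l1 = y & bcc_proj l2 = y].
Proof.
case: y => y1 y2 /triP H.
(* Subtracting (1, 1, 1) does not change the projection. *)
have lift (a b c : int) :
    (- a, - b, - c) \in bcc_dirs -> (- (a - 1), - (b - 1), - (c - 1)) \in bcc_dirs ->
    (2 %| a - b)%Z -> (2 %| a - c)%Z ->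
    (((val l).1.1 + a - ((val l).2 + c)) %/ 2)%Z = y1 ->
    (((val l).1.2 + b - ((val l).2 + c)) %/ 2)%Z = y2 ->
    exists l1 l2, [/\ l1 != l2, bcc_adj l l1, bcc_adj l l2,
      bcc_proj l1 = (y1, y2) & bcc_proj l2 = (y1, y2)].
  move=> d1 d2 ab ac h1 h2.
  have sub1 (u v : int) : u - 1 - (v - 1) = u - v by lia.
  have [l1 ll1 e1] := bcc_step l d1 ab ac.
  have [|| l2 ll2 e2] := bcc_step l d2; rewrite ?sub1 //.
  exists l1, l2; split=> //.
  - by apply/eqP => e; move: e1; rewrite e e2 => /addrI [] H1 _ _; lia.
  - by rewrite /bcc_proj e1 /= h1 h2.
  - by rewrite /bcc_proj e2 /= -h1 -h2; congr pair; congr (_ %/ _)%Z; ring.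
move: lift H; rewrite /= => lift -[[]|[[]|[[]|[[]|[[]|[]]]]]] e1 e2.
(* Each direction of the triangular lattice lifts to one vector of type (2, 0, 0) and one of type
   (1, 1, 1), up to signs and order. *)
- by apply: (lift 2 0 0) => //; lia.
- by apply: (lift (-1) 1 1) => //; lia.
- by apply: (lift 0 2 0) => //; lia.
- by apply: (lift 1 (-1) 1) => //; lia.
- by apply: (lift 1 1 (-1)) => //; lia.
- by apply: (lift 0 0 2) => //; lia.
Qed.

(** * An infinite cluster at density 3/10 *)

Section Percolation.
Variable R : realType.
Let o : bcc := Sub (0, 0, 0) isT.

Definition reaches_boundary n (w : bcc -> bool) := exists l,
  (exists2 z, tri (bcc_proj l) z & z \notin box n) /\ open_cluster bcc_adj w o l.

Lemma event_reaches_boundary n : event (reaches_boundary n).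
Proof.
apply: event_exists => l; apply: event_and; first exact: event_cst.
exact: event_cluster.
Qed.

(** The factor 3/10 is the probability that [o] is open; 1/101 is the triangular bound at 51/100 = 1
    - (7/10)^2. *)
Lemma reaches_boundary_ge n :
  ((3 / 10 * (1 / 101) : R)%:E <=
   bernoulli_product bcc (3 / 10 : R) [set w | reaches_boundary n w])%E.
Proof.
set p : R := 3 / 10; have p01 : 0 <= p <= 1 by rewrite /p; lra.
have po : bcc_proj o = 0 by [].
pose s := rem 0 (box n).
pose w' := upd (fun=> false) o true.
have us : uniq s by rewrite rem_uniq ?box_uniq.
have os : 0 \notin s by rewrite mem_rem_uniq ?box_uniq // inE eqxx.
have [s' [us' ps' E]] : exists s', [/\ uniq s', forall l, l \in s' -> bcc_proj l \in s &
    bexp (1 - (1 - p) ^+ 2) s (ind R (exits tri (box n) ^~ (bcc_proj o)))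
      (fun=> false) <=
    bexp p s' (ind R (leaves_over tri bcc_adj bcc_proj (box n) o)) w'].
  apply: (lift_exploration bcc_lift2) => // [v /mem_rem //|l].
  by rewrite /w' /upd; case: eqP => // -> ; rewrite po (negPf os).
have os' : o \notin s' by apply: contra os => /ps'; rewrite po.
have lower : 1 / 101 <=
    bexp p s' (ind R (leaves_over tri bcc_adj bcc_proj (box n) o)) w'.
  apply: le_trans E; apply: le_trans (exit_prob_lower R n) _.
  have -> : 51 / 100 = 1 - (1 - p) ^+ 2 :> R by rewrite /p; field.
  rewrite po /exit_prob; rewrite le_eqVlt; apply/orP; left; apply/eqP.
  apply: bexp_dep => //; [exact: box_uniq|by move=> v /mem_rem|].
  apply: dep_ind => w1 w2 e [y [z [r yz zL]]]; exists y, z; split=> //.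
  apply: reach_mono (reach_skip r) => v /and3P[v0 vb]; rewrite vb e //.
  by rewrite mem_rem_uniq ?box_uniq // inE v0.
(* Confining paths to [o :: s'] gives an event of finitely many sites that implies
   [reaches_boundary n]. *)
pose P (w : bcc -> bool) := w o /\
  leaves_over tri bcc_adj bcc_proj (box n) o (fun v => (v \in o :: s') && w v).
have u1 : uniq ((o :: s') ++ [::]) by rewrite cats0 /= os'.
have dP : dep ((o :: s') ++ [::]) (fun w => `[< P w >]).
  rewrite cats0 => w1 w2 e; congr asbool; rewrite /P e ?mem_head //.
  rewrite (_ : (fun v => _) = (fun v => (v \in o :: s') && w2 v)) //.
  by apply/funext => v; have [/e ->|//] := boolP (v \in o :: s').
have [mP EP] := bernoulli_product_bexp (fun=> false) p01 u1 dP.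
move: EP; rewrite big_nil mul1r => EP.
have sub : (bernoulli_product bcc p
      [set w : configuration bcc | {in [::], w =1 (fun=> false)} /\ P w] <=
    bernoulli_product bcc p [set w | reaches_boundary n w])%E.
  apply: le_measure; rewrite ?inE //; first exact: event_reaches_boundary.
  move=> w /= [_ [wo [l [z [r lz zL]]]]]; exists l; split; first by exists z.
  by apply: reach_cluster => //; apply: reach_mono r => v /andP[].
apply: le_trans sub; rewrite EP lee_fin /=.
have h0 : 0 <= bexp p s' (ind R P) (upd (fun=> false) o false).
  rewrite -(bexp_cst p s' 0 (upd (fun=> false) o false)); apply: le_bexp => // ? _.
have h1 : bexp p s' (ind R (leaves_over tri bcc_adj bcc_proj (box n) o)) w' <=
    bexp p s' (ind R P) (upd (fun=> false) o true).
  apply: le_bexp => // w e; apply: ind_le => -[l [z [r lz zL]]].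
  split; first by rewrite e // updE.
  exists l, z; split=> //; apply: reach_mono r => v wv; rewrite wv andbT inE.
  have [//|vo] := eqVneq v o; apply/negPn/negP => /= vs.
  by move: wv; rewrite e // /w' /upd (negPf vo).
have h2 : 1 / 101 <= bexp p s' (ind R P) (upd (fun=> false) o true).
  exact: le_trans lower h1.
have p0 : 0 <= p /\ 0 <= 1 - p by rewrite /p; split; lra.
rewrite -[leLHS]addr0; apply: lerD; first exact: ler_wpM2l p0.1 _ _ h2.
exact: mulr_ge0 p0.2 h0.
Qed.

(** The events [reaches_boundary n] decrease in [n], so continuity from above preserves the uniform
    lower bound. On their intersection the cluster of [o] is infinite: the projected neighbours of a
    finite cluster would all fit in one box. *)
Lemma percolation_pos :
  (0 < bernoulli_product bcc (3 / 10 : R) (percolation bcc_adj))%E.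
Proof.
set mu := bernoulli_product bcc (3 / 10 : R).
pose B n : set (configuration bcc) := [set w | reaches_boundary n w].
have mB n : measurable (B n) := event_reaches_boundary n.
have mI : measurable (\bigcap_n B n) by apply: bigcap_measurable => // n _; exact: mB.
have cv : mu (B n) @[n --> \oo] --> mu (\bigcap_n B n).
  apply: nonincreasing_cvg_mu => //.
    by rewrite (le_lt_trans (probability_le1 _ _)) ?ltry.
  move=> i j ij; apply/subsetPset => w [l [[z lz zn] c]]; exists l; split=> //.
  exists z => //; apply: contra zn; case: z {lz} => a b; rewrite !mem_box; lia.
apply: (@lt_le_trans _ _ (mu (\bigcap_n B n))).
  apply: (@lt_le_trans _ _ (3 / 10 * (1 / 101) : R)%:E); first by rewrite lte_fin; lra.
  rewrite -(cvg_lim _ cv) //; apply: lime_ge; first by apply/cvg_ex; eexists; exact: cv.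
  by apply: nearW => n; exact: reaches_boundary_ge.
apply: le_measure; rewrite ?inE //; first exact: event_percolation.
move=> w wB; exists o => /finite_seqP[s e].
have [n sn] := sub_box (flatten [seq tri_nb (bcc_proj l) | l <- s]).
have [l [[z lz /negP zn] c]] := wB n I; apply: zn; apply: sn.
apply/flattenP; exists (tri_nb (bcc_proj l)) => //; apply/mapP; exists l => //.
by move: c; rewrite e.
Qed.

End Percolation.

Theorem corollary2p7 (R : realType) : critical_threshold bcc_adj R < 1 / 3.
Proof.
apply: (@le_lt_trans _ _ (3 / 10)); last by lra.
apply: ge_inf; first by exists 0 => p [/andP[]].
by split; [lra|exact: percolation_pos].
Qed.
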